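(* Let $n,n'$ be positive integers, let $X,Y$ be disjoint subsets of $[n]$, and let $X',Y'$ be disjoint subsets of $[n']$. Let $\mathcal{A}$ and $\mathcal{B}$ be finite families (multisets) of elements of $\mathcal{C}_{X,Y,X',Y'}$. Then the following are equivalent: (i) the pair $(\mathcal{A},\mathcal{B})$ is TNN-universal, i.e. the inequality $$\sum_{(A,A')\in \mathcal{A}} \Delta_Q(X\cup A\,|\,X'\cup A')\, \Delta_Q(X\cup (Y-A)\,|\,X'\cup (Y'-A')) \;\ge\; \sum_{(B,B')\in \mathcal{B}} \Delta_Q(X\cup B\,|\,X'\cup B')\, \Delta_Q(X\cup (Y-B)\,|\,X'\cup (Y'-B'))$$ (sums taken with multiplicities) holds for every $n\times n'$ totally nonnegative matrix $Q$; (ii) for each matching $M\in\mathcal{M}(\mathcal{B})$, one has $\#_M(\mathcal{A})\ge \#_M(\mathcal{B})$.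
   Context: Notation: $[k]=\{1,\ldots,k\}$; $K-L$ denotes set difference; $\sqcup$ denotes disjoint union. Minors: for a real $n\times n'$ matrix $Q$ and $I\subseteq[n]$, $J\subseteq[n']$ with $|I|=|J|$, $\Delta_Q(I|J)$ is the determinant of the submatrix of $Q$ with row set $I$ and column set $J$ (rows and columns in increasing order); by convention $\Delta_Q(\emptyset|\emptyset)=1$. $Q$ is totally nonnegative (TNN) if $\Delta_Q(I|J)\ge 0$ for all such $(I,J)$. Proper pairs: $\mathcal{C}_{X,Y,X',Y'}$ is the set of pairs $(C,C')$ with $C\subseteq Y$, $C'\subseteq Y'$ such that $|X\cup C|=|X'\cup C'|$ and $|X\cup(Y-C)|=|X'\cup(Y'-C')|$. (If it is nonempty, then $2|X|+|Y|=2|X'|+|Y'|$, so $|Y|+|Y'|$ is even.) The families $\mathcal{A},\mathcal{B}$ may contain several copies of the same proper pair. Feasible matchings: place the elements of $Y$ as distinct points on the lower half, and the elements of $Y'$ as distinct points on the upper half, of a circle $O$ in the plane, so that in each half the elements follow in increasing order from left to right. (Elements of $Y$ and of $Y'$ are regarded as distinct even if they are equal as integers. Thus the cyclic order on $O$ is: elements of $Y$ in increasing order followed by elements of $Y'$ in decreasing order.) For a proper pair $(C,C')$, the elements of $C\sqcup C'$ are called white and the elements of $(Y-C)\sqcup(Y'-C')$ are called black. A perfect matching $M$ on $Y\sqcup Y'$ is a partition of $Y\sqcup Y'$ into 2-element subsets, called couples. $M$ is feasible for $(C,C')$ if: (1) for each couple $\pi\in M$: if its two elements have different colors, then both lie in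 the same half of $O$ (both in $Y$ or both in $Y'$); if they have the same color, then they lie in different halves (one in $Y$, the other in $Y'$); (2) $M$ is planar: the chords of $O$ connecting the couples of $M$ are pairwise non-intersecting. $\mathcal{M}_{C,C'}$ denotes the set of matchings feasible for $(C,C')$. For a family $\mathcal{A}$ of proper pairs, $\mathcal{M}(\mathcal{A})$ denotes the family (with multiplicities) of all matchings occurring in the sets $\mathcal{M}_{C,C'}$ over all $(C,C')\in\mathcal{A}$, and $\#_M(\mathcal{A})$ denotes the number of occurrences of $M$ in $\mathcal{M}(\mathcal{A})$, i.e. the number of members $(C,C')$ of $\mathcal{A}$, counted with multiplicity, such that $M\in\mathcal{M}_{C,C'}$. *)

(* Defs.v *)
From HB Require Import structures.
From mathcomp Require Import all_boot all_order all_algebra.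
From mathcomp Require Import reals.

Set Implicit Arguments.
Unset Strict Implicit.
Unset Printing Implicit Defensive.

Import Order.TTheory GRing.Theory Num.Theory.

Local Open Scope ring_scope.

(** [enum_val] lists a set of ordinals in increasing order.  The cardinality
    condition on the row and column sets is decided, so that minors can be
    written without a proof argument; the value 0 for sets of different sizes
    is never used on proper pairs. *)
Definition minor (R : comNzRingType) (n n' : nat) (Q : 'M[R]_(n, n'))
    (I : {set 'I_n}) (J : {set 'I_n'}) : R :=
  match #|I| =P #|J| with
  | ReflectT eqIJ =>
      \det (\matrix_(i < #|I|, j < #|I|)
              Q (enum_val i) (enum_val (cast_ord eqIJ j)))
  | ReflectF _ => 0
  end.

Definition tnn (R : realType) (n n' : nat) (Q : 'M[R]_(n, n')) : Prop :=
  forall (I : {set 'I_n}) (J : {set 'I_n'}),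
    #|I| = #|J| -> 0 <= minor Q I J.

Definition proper_pairs (n n' : nat)
    (X Y : {set 'I_n}) (X' Y' : {set 'I_n'}) :
    {set {set 'I_n} * {set 'I_n'}} :=
  [set p : {set 'I_n} * {set 'I_n'} |
    [&& p.1 \subset Y, p.2 \subset Y',
        #|X :|: p.1| == #|X' :|: p.2|
      & #|X :|: (Y :\: p.1)| == #|X' :|: (Y' :\: p.2)| ]].

Definition minor_product (n n' : nat)
    (X Y : {set 'I_n}) (X' Y' : {set 'I_n'})
    (R : realType) (Q : 'M[R]_(n, n'))
    (p : {set 'I_n} * {set 'I_n'}) : R :=
  minor Q (X :|: p.1) (X' :|: p.2) *
  minor Q (X :|: (Y :\: p.1)) (X' :|: (Y' :\: p.2)).

(** Finite families with multiplicities are sequences; nothing below depends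
    on the order of their members. *)
Definition tnn_universal (n n' : nat)
    (X Y : {set 'I_n}) (X' Y' : {set 'I_n'}) (R : realType)
    (AA BB : seq ({set 'I_n} * {set 'I_n'})) : Prop :=
  forall Q : 'M[R]_(n, n'), tnn Q ->
    \sum_(p <- AA) minor_product X Y X' Y' Q p
      >= \sum_(p <- BB) minor_product X Y X' Y' Q p.

(** [inl i] is the point of the lower half of the circle labelled [i], and
    [inr j] the point of the upper half labelled [j]. *)
Definition point (n n' : nat) : finType := ('I_n + 'I_n')%type.

Definition lower (n n' : nat) (u : point n n') : bool := if u is inl _ then true else false.

Definition points (n n' : nat) (Y : {set 'I_n}) (Y' : {set 'I_n'}) :
    {set point n n'} :=
  (inl @: Y) :|: (inr @: Y').

Definition white (n n' : nat)
    (p : {set 'I_n} * {set 'I_n'}) (u : point n n') : bool :=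
  match u with
  | inl i => i \in p.1
  | inr j => j \in p.2
  end.

Definition perfect_matching (n n' : nat)
    (Y : {set 'I_n}) (Y' : {set 'I_n'})
    (M : {set {set point n n'}}) : bool :=
  partition M (points Y Y') && [forall c in M, #|c| == 2%N].

(** Rank of a point when the circle is traversed counterclockwise from its
    leftmost point: the lower half from left to right, then the upper half
    from right to left. *)
Definition circle_pos (n n' : nat) (u : point n n') : nat :=
  match u with
  | inl i => i
  | inr j => (n + rev_ord j)%N
  end.

(** Chords with endpoints [a], [b] and [c], [d] intersect exactly when their
    endpoints alternate around the circle.  Since the couples and their
    elements are quantified in all orders, and a couple has only two elements,
    one alternating pattern suffices and distinctness of the couples need not
    be required. *)
Definition planar (n n' : nat) (M : {set {set point n n'}}) : bool :=
  [forall c1 in M, forall c2 in M,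
    forall a in c1, forall b in c1, forall c in c2, forall d in c2,
    ~~ [&& circle_pos a < circle_pos c,
           circle_pos c < circle_pos b
         & circle_pos b < circle_pos d]%N].

Definition color_compatible (n n' : nat)
    (p : {set 'I_n} * {set 'I_n'}) (M : {set {set point n n'}}) : bool :=
  [forall c in M, forall u in c, forall v in c, (u != v) ==>
    ((white p u != white p v) ==> (lower u == lower v)) &&
    ((white p u == white p v) ==> (lower u != lower v))].

Definition feasible_matchings (n n' : nat)
    (Y : {set 'I_n}) (Y' : {set 'I_n'})
    (p : {set 'I_n} * {set 'I_n'}) : {set {set {set point n n'}}} :=
  [set M | [&& perfect_matching Y Y' M, color_compatible p M & planar M]].

Definition matchings (n n' : nat)
    (Y : {set 'I_n}) (Y' : {set 'I_n'})
    (AA : seq ({set 'I_n} * {set 'I_n'})) : seq {set {set point n n'}} :=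
  flatten [seq enum (feasible_matchings Y Y' p) | p <- AA].

Definition num_matching (n n' : nat)
    (Y : {set 'I_n}) (Y' : {set 'I_n'})
    (M : {set {set point n n'}})
    (AA : seq ({set 'I_n} * {set 'I_n'})) : nat :=
  count_mem M (matchings Y Y' AA).

(* Main.v *)
(** Index minors by sets of circle points: [Delta Q S] is the minor whose rows are the
    lower points in [S] and whose columns are the upper points outside [S].  With the
    colours of the upper points flipped accordingly, a matching is feasible iff it is
    noncrossing and bichromatic.  Adding [t] times a row (column) to a neighbouring one,
    or [t] to a corner entry, acts on [Delta] in a uniform way, by sliding elements of
    [S] from [a] to [b] for two points [a], [b] that are adjacent on the circle.  Under
    such a slide a sum of products [Delta (X :|: C) * Delta (X :|: (Y :\: C))]
    weighted by [d C] becomes a polynomial in [t] whose coefficients are weighted sums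
    of the same kind, for smaller or relabelled [X], [Y] and new weights; the sums of
    [d] over the colourings of a noncrossing matching transform in the same manner,
    by inserting, contracting or relabelling a couple.

    (ii) => (i): every totally nonnegative matrix is built from 0 by such slides with
    [t >= 0] (Neville elimination), so that the products of minors stay in the cone
    dual to the matching sums.

    (i) => (ii): conversely slides preserve total nonnegativity; the leading coefficient
    in [t] of a polynomial which is nonnegative for [t >= 0] is nonnegative, and the
    leading coefficients remove an innermost couple of the given matching, after moving
    its ends next to each other. *)

Require Import Defs.
From HB Require Import structures.
From mathcomp Require Import all_boot all_order all_algebra.
From mathcomp Require Import reals.
From mathcomp Require Import perm zify ring lra.

Set Implicit Arguments.
Unset Strict Implicit.
Unset Printing Implicit Defensive.

Import Order.TTheory GRing.Theory Num.Theory.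

Local Open Scope ring_scope.

(** * Noncrossing matchings *)

(** A matching is a fixed-point-free involution of [Y], with arbitrary values outside [Y], so that
    it can be conjugated by transpositions. One alternating pattern suffices, since [x] and [y] may
    be any ends of their chords. *)
Definition noncrossing (T : finType) (pos : T -> nat) (Y : {set T}) (f : T -> T) : Prop :=
  [/\ {in Y, forall y, f y \in Y}, {in Y, forall y, f y != y}, {in Y, involutive f}
    & {in Y &, forall x y, ~~ [&& pos x < pos y, pos y < pos (f x) & pos (f x) < pos (f y)]%N}].

Definition bichromatic (T : finType) (Y : {set T}) (f : T -> T) (C : {set T}) : bool :=
  [forall y in Y, (f y \in C) != (y \in C)].

(** Adjacency relative to [Y] only: other points may lie between [a] and [b], which may come in
    either order. *)
Definition no_between (T : finType) (pos : T -> nat) (Y : {set T}) (a b : T) : Prop :=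
  {in Y, forall z, ~~ (pos a < pos z < pos b)%N && ~~ (pos b < pos z < pos a)%N}.

Definition enclosed (T : Type) (pos : T -> nat) (f : T -> T) (y z : T) : bool :=
  (pos y < pos z < pos (f y))%N || (pos (f y) < pos z < pos y)%N.

Section Noncrossing.
Variables (T : finType) (pos : T -> nat).
Hypothesis pos_inj : injective pos.
Implicit Types (X Y C : {set T}) (f : T -> T) (a b : T).

Definition pairing a b f (x : T) : T := if x == a then b else if x == b then a else f x.

(** One of the arcs cut off by the new chord contains no end of another chord. *)
Lemma noncrossing_cup Y f a b :
  noncrossing pos Y f -> a \notin Y -> b \notin Y -> a != b -> no_between pos Y a b ->
  noncrossing pos (a |: (b |: Y)) (pairing a b f).
Proof.
case=> fY fne ff fnc aY bY ab nb.
have dY y : y \in Y -> (y == a = false) * (y == b = false).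
  by move=> yY; split; apply/negP=> /eqP e; move: yY; rewrite e ?(negbTE aY) ?(negbTE bY).
have ba : b == a = false by rewrite eq_sym (negbTE ab).
have Pa : pairing a b f a = b by rewrite /pairing eqxx.
have Pb : pairing a b f b = a by rewrite /pairing eqxx ba.
have PY y : y \in Y -> pairing a b f y = f y by move=> yY; rewrite /pairing !dY.
split.
- move=> y; rewrite !inE => /or3P[/eqP->|/eqP->|yY]; rewrite ?Pa ?Pb ?PY ?eqxx ?orbT //.
  by rewrite fY ?orbT.
- move=> y; rewrite !inE => /or3P[/eqP->|/eqP->|yY]; rewrite ?Pa ?Pb ?PY ?fne ?ba //.
- by move=> y; rewrite !inE => /or3P[/eqP->|/eqP->|yY]; rewrite ?Pa ?Pb ?(Pa, Pb) // PY ?PY ?fY ?ff.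
- move=> x y; rewrite !inE => /or3P[/eqP->|/eqP->|xY] /or3P[/eqP->|/eqP->|yY];
    rewrite ?Pa ?Pb ?PY // ?ltnn ?andbF //.
  + by have := nb _ yY; lia.
  + by have := nb _ yY; lia.
  + by have := nb _ (fY _ xY); lia.
  + by have := nb _ (fY _ xY); lia.
  + exact: fnc.
Qed.

Lemma bichromaticP Y f C :
  reflect {in Y, forall y, (f y \in C) = (y \notin C)} (bichromatic Y f C).
Proof.
apply: (iffP (forall_inP )) => h y yY; have := h y yY.
  by do 2!case: (_ \in C).
by move=> ->; case: (_ \in C).
Qed.

Lemma noncrossing_remove Y f a b :
  noncrossing pos Y f -> a \in Y -> f a = b -> noncrossing pos (Y :\ a :\ b) f.
Proof.
case=> fY fne ff fnc aY fab.
have sub y : y \in Y :\ a :\ b -> y \in Y by rewrite !inE => /and3P[].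
have fb : f b = a by rewrite -fab ff.
split.
- move=> y; rewrite !inE => /and3P[yb ya yY']; rewrite fY // andbT; apply/andP; split.
    by apply: contra_neq ya => e; rewrite -(ff y yY') e.
  by apply: contra_neq yb => e; rewrite -(ff y yY') e.
- by move=> y /sub; exact: fne.
- by move=> y /sub; exact: ff.
- by move=> x y /sub xY /sub yY; exact: fnc.
Qed.

(** A chord that does not cross the chord of [y] has both ends on the same side of it. *)
Lemma noncrossing_enclosed Y f x y : noncrossing pos Y f -> y \in Y -> x \in Y ->
  x != y -> x != f y -> enclosed pos f y x = enclosed pos f y (f x).
Proof.
case=> fY fne ff fnc yY xY xy xfy; rewrite /enclosed.
have N z w : z != w -> pos z <> pos w by move=> /eqP zw /pos_inj.
have fxy : f x != y by apply: contra_neq xfy => <-; rewrite ff.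
have fxfy : f x != f y by apply: contra_neq xy => /(congr1 f); rewrite !ff.
move: (N _ _ xy) (N _ _ xfy) (N _ _ fxy) (N _ _ fxfy).
(* All choices of an end of each chord and of the chord that comes first; what remains is arithmetic
   on four positions. *)
move: (fnc _ _ xY yY) (fnc _ _ yY xY) (fnc _ _ xY (fY _ yY)) (fnc _ _ (fY _ yY) xY)
  (fnc _ _ (fY _ xY) yY) (fnc _ _ yY (fY _ xY)) (fnc _ _ (fY _ xY) (fY _ yY))
  (fnc _ _ (fY _ yY) (fY _ xY)).
rewrite !ff //; clear; move: (pos x) (pos y) (pos (f x)) (pos (f y)) => a b c d.
case: (ltngtP a b); case: (ltngtP a d); case: (ltngtP c b); case: (ltngtP c d); 
  rewrite /= ?andbT ?andbF ?orbF ?orbT //=; lia.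
Qed.

Definition contract a b f (x : T) : T :=
  if x == f a then f b else if x == f b then f a else f x.

(** The new chord can be drawn along the chord from [f a] to [a], across the gap to [b], and along
    the chord from [b] to [f b]; another chord meets none of these pieces. *)
Lemma noncrossing_contract Y f a b :
  noncrossing pos Y f -> a \in Y -> b \in Y -> a != b -> f a != b -> no_between pos Y a b ->
  noncrossing pos (Y :\ a :\ b) (contract a b f).
Proof.
move=> nc aY bY ab fab nb; have [fY fne ff fnc] := nc.
have ba : b == a = false by rewrite eq_sym (negbTE ab).
have fba : f b != a by apply: contraNneq fab => <-; rewrite ff.
have uv : f a != f b by apply: contraNneq ab => /(congr1 f); rewrite !ff // => ->.
have vu : f b == f a = false by rewrite eq_sym (negbTE uv).
have Cu : contract a b f (f a) = f b by rewrite /contract eqxx.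
have Cv : contract a b f (f b) = f a by rewrite /contract vu eqxx.
have CY y : y != f a -> y != f b -> contract a b f y = f y.
  by rewrite /contract => /negbTE-> /negbTE->.
have fa := fne _ aY; have fb := fne _ bY.
have view y : y \in Y :\ a :\ b -> [\/ y = f a, y = f b |
    [/\ y \in Y, y != a, y != b, y != f a & y != f b]].
  rewrite !inE => /and3P[yb ya yY].
  case: (eqVneq y (f a)) => [->|y1]; first by constructor 1.
  case: (eqVneq y (f b)) => [->|y2]; first by constructor 2.
  by constructor 3.
have uY : f a \in Y :\ a :\ b by rewrite !inE fab fa fY.
have vY : f b \in Y :\ a :\ b by rewrite !inE fba fb fY.
have fin y : y \in Y -> y != a -> y != b -> y != f a -> y != f b ->
    [/\ f y != a, f y != b, f y != f a & f y != f b].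
  move=> yY ya yb yu yv; split; [apply: contraNneq yu|apply: contraNneq yv
   |apply: contraNneq ya|apply: contraNneq yb].
  - by move=> <-; rewrite ff. - by move=> <-; rewrite ff.
  - by move=> /(congr1 f); rewrite !ff // => ->.
  - by move=> /(congr1 f); rewrite !ff // => ->.
split.
- move=> y /view[->|->|[yY ya yb yu yv]]; rewrite ?Cu ?Cv ?CY //.
  by have [? ? ? ?] := fin _ yY ya yb yu yv; rewrite !inE fY //; apply/and3P.
- move=> y /view[->|->|[yY ya yb yu yv]]; rewrite ?Cu ?Cv ?CY //; first by rewrite vu.
  exact: fne.
- move=> y /view[->|->|[yY ya yb yu yv]]; rewrite ?Cu ?Cv ?(CY y) ?Cu ?Cv //.
  by have [? ? ? ?] := fin _ yY ya yb yu yv; rewrite CY ?ff.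
(* None of the three pieces of the new chord changes the side of the chord of [y]. *)
have key y : y \in Y -> y != a -> y != b -> y != f a -> y != f b ->
    enclosed pos f y (f a) = enclosed pos f y (f b).
  move=> yY ya yb yu yv; have [ua ub uu uv'] := fin _ yY ya yb yu yv.
  rewrite -(noncrossing_enclosed nc yY aY) 1?eq_sym // 1?eq_sym //.
  rewrite -(noncrossing_enclosed nc yY bY) 1?eq_sym // 1?eq_sym //.
  have N z w : z != w -> pos z <> pos w by move=> /eqP zw /pos_inj.
  move: (nb _ yY) (nb _ (fY _ yY)) (N _ _ ya) (N _ _ yb) (N _ _ ua) (N _ _ ub).
  by rewrite /enclosed; clear; lia.
move=> x y /view[->|->|[xY xa xb xu xv]] /view[->|->|[yY ya yb yu yv]];
  rewrite ?Cu ?Cv ?(CY x) ?(CY y) // ?ltnn ?andbF //.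
- by have := key _ yY ya yb yu yv; rewrite /enclosed; clear; lia.
- by have := key _ yY ya yb yu yv; rewrite /enclosed; clear; lia.
- by have := key _ xY xa xb xu xv; rewrite /enclosed; clear; lia.
- by have := key _ xY xa xb xu xv; rewrite /enclosed; clear; lia.
- exact: fnc.
Qed.

(** Moving an end from [b] to the free place [a] passes over no element of [Y], so the order of the
    ends is unchanged. *)
Lemma noncrossing_tperm Y f a b :
  noncrossing pos Y f -> a \notin Y -> b \in Y -> no_between pos Y a b ->
  noncrossing pos (tperm a b @: Y) (tperm a b \o f \o tperm a b).
Proof.
move=> [fY fne ff fnc] aY bY nb; set s := tperm a b.
have ss : involutive s by exact: tpermK.
have mono x y : x \in Y -> y \in Y -> (pos (s x) < pos (s y))%N -> (pos x < pos y)%N.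
  move=> xY yY; have Ny z : z \in Y -> z != a by move=> zY; apply: contraNneq aY => <-.
  have N z w : z != w -> pos z <> pos w by move=> /eqP zw /pos_inj.
  have [xa ya] := (Ny _ xY, Ny _ yY).
  have := nb _ xY; have := nb _ yY; have := N _ _ xa; have := N _ _ ya.
  rewrite /s; case: (tpermP a b x) xa => [->|->|_ /eqP xb]; rewrite ?eqxx //;
  case: (tpermP a b y) ya => [->|->|_ /eqP yb]; rewrite ?eqxx //; try lia.
  - by move=> _ _; have := N _ _ yb; lia.
  - by move=> _ _; have := N _ _ xb; lia.
split.
- by move=> _ /imsetP[y yY ->]; rewrite /= ss mem_imset ?fY //; exact: perm_inj.
- by move=> _ /imsetP[y yY ->]; rewrite /= ss (inj_eq perm_inj) fne.
- by move=> _ /imsetP[y yY ->]; rewrite /= ss ss ff.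
- move=> _ _ /imsetP[x xY ->] /imsetP[y yY ->]; rewrite /= !ss.
  apply/negP=> /and3P[h1 h2 h3]; have /negP := fnc _ _ xY yY; apply.
  by apply/and3P; split; apply: mono; rewrite ?fY.
Qed.

(** A couple of smallest span works: an element strictly inside it would have its partner inside as
    well, which gives a shorter couple. *)
Lemma noncrossing_innermost Y f : noncrossing pos Y f -> Y != set0 ->
  exists a, [/\ a \in Y, (pos a < pos (f a))%N & no_between pos Y a (f a)].
Proof.
case=> fY fne ff fnc /set0Pn[y0 y0Y].
have N z w : z != w -> pos z <> pos w by move=> /eqP zw /pos_inj.
have [y1 /andP[y1Y lt1]] : exists y1, (y1 \in Y) && (pos y1 < pos (f y1))%N.
  have := N _ _ (fne _ y0Y).
  case: (ltngtP (pos y0) (pos (f y0))) => [h _|h _|-> //].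
    by exists y0; rewrite y0Y.
  by exists (f y0); rewrite fY // ff.
case: (arg_minnP (P := fun y => (y \in Y) && (pos y < pos (f y))%N)
  (fun y => (pos (f y) - pos y)%N) (i0 := y1)); first by rewrite y1Y.
move=> a /andP[aY lta] min; exists a; split=> // z zY.
suff h : ~~ (pos a < pos z < pos (f a))%N by lia.
apply/negP=> hz; have := fnc _ _ aY zY; have := fnc _ _ (fY _ zY) aY.
have := fnc _ _ aY (fY _ zY); have := fnc _ _ (fY _ zY) (fY _ aY).
have := fnc _ _ (fY _ aY) zY.
have := fnc _ _ zY aY; have := fnc _ _ zY (fY _ aY).
have za : z != a by apply/eqP => e; move: hz; rewrite e; lia.
have zfa : z != f a by apply/eqP => e; move: hz; rewrite e; lia.
have fza : f z != a by apply: contraNneq zfa => <-; rewrite ff.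
have fzfa : f z != f a by apply: contraNneq za => /(congr1 f); rewrite !ff // => ->.
have := min z; have := min (f z); rewrite !ff // zY fY //=.
move: (N _ _ fza) (N _ _ fzfa) (N _ _ (fne _ zY)) hz; clear.
move: (pos a) (pos z) (pos (f a)) (pos (f z)) => A B u v. lia.
Qed.

End Noncrossing.

(** * Weighted sums of products under slides *)

Lemma big_subsets_setD1 (V : zmodType) (T : finType) (Y : {set T}) (a : T)
    (F : {set T} -> V) : a \in Y ->
  \sum_(C : {set T} | C \subset Y) F C =
  \sum_(C : {set T} | C \subset Y :\ a) (F C + F (a |: C)).
Proof.
move=> aY; rewrite (bigID (fun C : {set T} => a \in C)) /= addrC big_split; congr (_ + _).
  by apply: eq_bigl => C; rewrite subsetD1.
rewrite (reindex_onto (fun C => a |: C) (fun C => C :\ a)) /=; last first.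
  by move=> C /andP[_ aC]; rewrite setD1K.
apply: eq_bigl => C; rewrite subUset sub1set aY setU11 andbT /= subsetD1; congr (_ && _).
by apply/eqP/idP => [<-|/setU1K//]; rewrite !inE eqxx.
Qed.

Section ProductSum.
Variables (R : realFieldType) (T : finType).
Implicit Types (D d : {set T} -> R) (X Y C S : {set T}) (f : T -> T) (a b : T) (t : R).

(** When [d] is the difference of the multiplicities in two families, this will be the difference of
    the two sides of the inequality, and [matching_sum] the difference of the two counts of a
    matching. *)
Definition product_sum X Y D d : R :=
  \sum_(C : {set T} | C \subset Y) d C * (D (X :|: C) * D (X :|: (Y :\: C))).

Definition matching_sum Y f d : R :=
  \sum_(C : {set T} | C \subset Y) d C * (bichromatic Y f C)%:R.

(** Pluecker coordinates change in this way when [t] times one row is added to an adjacent row;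
    adjacency makes the sign positive. *)
Definition slide a b t D S : R :=
  D S + t * (if (a \in S) && (b \notin S) then D (b |: S :\ a) else 0).

Lemma slide_in a b t D S : a \in S -> b \notin S -> slide a b t D S = D S + t * D (b |: S :\ a).
Proof. by rewrite /slide => -> ->. Qed.

Lemma slide_out a b t D S : (a \notin S) || (b \in S) -> slide a b t D S = D S.
Proof. by rewrite /slide; case: (a \in S); case: (b \in S) => //= _; rewrite mulr0 addr0. Qed.

Ltac bool_cases := by do ?case: (_ \in _); do ?case: (_ == _).

(** The first of four cases for the places of [a] and [b]: here no factor contains [a] without
    [b]. *)
Lemma product_sum_slide_same X Y D d a b t : a != b ->
  (a \notin X :|: Y) || (b \in X) ->
  product_sum X Y (slide a b t D) d = product_sum X Y D d.
Proof.
move=> ab h; apply: eq_bigr => C CY; rewrite !slide_out //.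
  by move: h; rewrite !inE; case: (a \in X); case: (b \in X); case: (a \in Y);
    rewrite ?orbT ?andbF //= => _.
move: h (subsetP CY a); rewrite !inE; case: (a \in X); case: (b \in X); rewrite ?orbT //=.
by rewrite orbF; case: (a \in C) => // h /(_ isT) e; rewrite e in h.
Qed.

Lemma setD_notin C Y z : C \subset Y -> z \notin Y -> z \in C = false.
Proof. by move=> CY; apply: contraNF; exact: subsetP CY z. Qed.

(** Only colourings that separate [a] from [b] are affected. The factor with [a] trades it for [b],
    which the other factor already has; so [b] joins the common part [X] and [a] disappears. *)
Lemma product_sum_slide_both X Y D d a b t : [disjoint X & Y] -> a != b ->
  a \in Y -> b \in Y ->
  product_sum X Y (slide a b t D) d = product_sum X Y D d +
    t * product_sum (b |: X) (Y :\ a :\ b) D (fun C => d (a |: C) + d (b |: C)).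
Proof.
move=> XY ab aY bY; have ba : b == a = false by rewrite eq_sym (negbTE ab).
have ab' := negbTE ab.
have aX : a \in X = false by apply/negP => aX; have := disjointFr XY aX; rewrite aY.
have bX : b \in X = false by apply/negP => bX; have := disjointFr XY bX; rewrite bY.
have bYa : b \in Y :\ a by rewrite !inE ba bY.
rewrite /product_sum !(big_subsets_setD1 _ aY) !(big_subsets_setD1 _ bYa) mulr_sumr -big_split.
apply: eq_bigr => C CY /=.
have aC : a \in C = false by apply: setD_notin CY _; rewrite !inE eqxx /= andbF.
have bC : b \in C = false by apply: setD_notin CY _; rewrite !inE eqxx.
rewrite [slide a b t D (X :|: C)]slide_out; last by rewrite !inE aX aC.
rewrite [slide a b t D (X :|: (Y :\: C))]slide_out; last by rewrite !inE bY bC !orbT.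
rewrite [slide a b t D (X :|: (b |: C))]slide_out; last by rewrite !inE !eqxx !orbT.
rewrite [slide a b t D (X :|: (a |: (b |: C)))]slide_out; last by rewrite !inE !eqxx !orbT.
rewrite [slide a b t D (X :|: (Y :\: (a |: C)))]slide_out; last by rewrite !inE aX !eqxx.
rewrite [slide a b t D (X :|: (Y :\: (a |: (b |: C))))]slide_out; last first.
  by rewrite !inE aX !eqxx.
rewrite [slide a b t D (X :|: (a |: C))]slide_in; rewrite ?inE ?eqxx ?orbT /= ?bX ?ba ?bC //.
rewrite [slide a b t D (X :|: (Y :\: (b |: C)))]slide_in; 
  rewrite ?inE ?eqxx ?orbT /= ?bX ?ab' ?aC ?bC ?aY ?orbT //.
have -> : b |: (X :|: (a |: C)) :\ a = b |: X :|: C.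
  apply/setP=> z; rewrite !inE; case: (eqVneq z a) => [->|_]; rewrite ?aX ?aC ?ab' //=; bool_cases.
have -> : b |: (X :|: (Y :\: (b |: C))) :\ a = b |: X :|: (Y :\ a :\ b :\: C).
  apply/setP=> z; rewrite !inE; case: (eqVneq z a) => [->|_]; rewrite ?aX ?aC ?ab' //=; bool_cases.
have -> : X :|: (Y :\: (a |: C)) = b |: X :|: (Y :\ a :\ b :\: C).
  apply/setP=> z; rewrite !inE; case: (eqVneq z b) => [->|_]; rewrite ?bC ?bY ?ba ?orbT //=;
    bool_cases.
have -> : X :|: (b |: C) = b |: X :|: C.
  by rewrite setUCA setUA.
ring.
Qed.

Lemma mem_imset_tperm a b S x : (x \in tperm a b @: S) = (tperm a b x \in S).
Proof. by rewrite -{1}(tpermK a b x) mem_imset //; exact: perm_inj. Qed.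

Lemma imset_tperm_swap a b S : a \in S -> b \notin S -> tperm a b @: S = b |: S :\ a.
Proof.
move=> aS bS; have ba : b != a by apply: contraNneq bS => ->.
apply/setP=> z; rewrite mem_imset_tperm !inE.
case: tpermP => [->|->|/eqP/negbTE-> /eqP/negbTE->] //.
  by rewrite eqxx (negbTE bS) andFb orbF eq_sym (negbTE ba).
by rewrite eqxx aS.
Qed.

Lemma imset_tperm_id a b S : (a \in S) = (b \in S) -> tperm a b @: S = S.
Proof. by move=> e; apply/setP=> z; rewrite mem_imset_tperm; case: tpermP => // ->. Qed.

Lemma imset_tpermK a b : involutive (fun S => tperm a b @: S).
Proof. by move=> S; apply/setP=> z; rewrite !mem_imset_tperm tpermK. Qed.

Lemma imset_tpermS a b S Y : (tperm a b @: S \subset tperm a b @: Y) = (S \subset Y).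
Proof.
apply/idP/idP; last exact: imsetS.
by move=> /(imsetS (tperm a b)); rewrite !imset_tpermK.
Qed.

(** In each product exactly one factor contains [a] without [b], and sliding replaces it with its
    image under [tperm a b]. The other factor contains both or neither of the two points and is its
    own image. *)
Lemma product_sum_slide_one X Y D d a b t : [disjoint X & Y] -> a != b ->
  (a \in Y) && (b \notin X :|: Y) || (a \in X) && (b \in Y) ->
  product_sum X Y (slide a b t D) d = product_sum X Y D d +
    t * product_sum (tperm a b @: X) (tperm a b @: Y) D (fun C => d (tperm a b @: C)).
Proof.
move=> XY ab h; rewrite [in X in t * X]/product_sum.
rewrite (reindex_inj (inv_inj (imset_tpermK a b))) /=.
rewrite mulr_sumr [X in _ + X](eq_bigl (fun C => C \subset Y)); last first.
  by move=> C; rewrite imset_tpermS.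
rewrite /product_sum -big_split; apply: eq_bigr => C CY /=.
rewrite imset_tpermK; have st (Z : {set T}) : tperm a b @: Z = [set x | tperm a b x \in Z].
  by apply/setP=> x; rewrite mem_imset_tperm inE.
have -> : tperm a b @: X :|: tperm a b @: C = tperm a b @: (X :|: C) by rewrite imsetU.
have -> : tperm a b @: X :|: (tperm a b @: Y :\: tperm a b @: C) =
    tperm a b @: (X :|: (Y :\: C)) by apply/setP=> z; rewrite !st !inE.
have ba : b == a = false by rewrite eq_sym (negbTE ab).
have inC z : z \in C -> z \in Y := subsetP CY z.
case/orP: h => /andP[h1 h2].
  move: h2; rewrite inE negb_or => /andP[bX bY].
  have aX : a \notin X by apply/negP => aX; have := disjointFr XY aX; rewrite h1.
  have bC : b \notin C by apply: contraNN bY; exact: inC.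
  case: (boolP (a \in C)) => aC.
    rewrite [slide _ _ _ _ (X :|: C)]slide_in; rewrite ?inE ?aC ?orbT ?(negbTE bX) ?bC //.
    rewrite imset_tperm_swap ?inE ?aC ?orbT ?(negbTE bX) ?bC //.
    rewrite slide_out ?[X in D X * D _ = _]imset_tperm_id; last by rewrite !inE (negbTE aX) aC.
    rewrite [tperm a b @: _]imset_tperm_id; first by ring.
    by rewrite !inE (negbTE aX) (negbTE bX) aC (negbTE bY) andbF.
  rewrite [slide _ _ _ _ (X :|: C)]slide_out; last by rewrite !inE (negbTE aX) (negbTE aC).
  rewrite slide_in; rewrite ?inE ?(negbTE aX) ?(negbTE aC) ?h1 ?(negbTE bX) ?(negbTE bY) ?andbF //.
  rewrite -imset_tperm_swap ?inE ?(negbTE aX) ?(negbTE aC) ?h1 ?(negbTE bX) ?(negbTE bY) ?andbF //.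
  rewrite [tperm a b @: (X :|: C)]imset_tperm_id; first by ring.
  by rewrite !inE (negbTE aX) (negbTE bX) (negbTE aC) (negbTE bC).
have aY : a \notin Y by rewrite (disjointFr XY h1).
have bX : b \notin X by apply/negP => aX; have := disjointFr XY aX; rewrite h2.
have aC : a \notin C by apply: contraNN aY; exact: inC.
case: (boolP (b \in C)) => bC.
  rewrite [slide _ _ _ _ (X :|: C)]slide_out; last by rewrite !inE bC !orbT.
  rewrite slide_in; rewrite ?inE ?h1 ?(negbTE bX) ?bC //.
  rewrite -imset_tperm_swap ?inE ?h1 ?(negbTE bX) ?bC //.
  rewrite [tperm a b @: (X :|: C)]imset_tperm_id; first by ring.
  by rewrite !inE h1 bC orbT.
rewrite slide_in; rewrite ?inE ?h1 ?(negbTE bX) ?(negbTE bC) //.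
rewrite slide_out; last by rewrite !inE h2 bC !orbT.
rewrite -imset_tperm_swap ?inE ?h1 ?(negbTE bX) ?(negbTE bC) //.
rewrite [tperm a b @: (X :|: (Y :\: C))]imset_tperm_id; first by ring.
by rewrite !inE h1 h2 bC orbT.
Qed.

Lemma eq_set_off2 a b S1 S2 : (a \in S1) = (a \in S2) -> (b \in S1) = (b \in S2) ->
  (forall z, z != a -> z != b -> (z \in S1) = (z \in S2)) -> S1 = S2.
Proof.
move=> h1 h2 h3; apply/setP=> z; case: (eqVneq z a) => [->//|za].
by case: (eqVneq z b) => [->//|zb]; exact: h3.
Qed.

(** Both factors contain [a] and neither contains [b], so both slide. In the mixed term one factor
    has kept [a] and the other has [b]: the two points have become elements of [Y] of opposite
    colours. *)
Lemma product_sum_slide_left X Y D d a b t : [disjoint X & Y] -> a \in X ->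
  b \notin X :|: Y ->
  product_sum X Y (slide a b t D) d = product_sum X Y D d +
    t * product_sum (X :\ a) (a |: (b |: Y)) D
          (fun C => if (a \in C) != (b \in C) then d (C :\ a :\ b) else 0) +
    t ^+ 2 * product_sum (b |: X :\ a) Y D d.
Proof.
move=> XY aX; rewrite inE negb_or => /andP[bX bY].
have aY : a \in Y = false by rewrite (disjointFr XY aX).
have ab : a == b = false by apply/negbTE; apply: contraNneq bX => <-.
have ba : b == a = false by rewrite eq_sym.
have abY : a \notin b |: Y by rewrite !inE ab aY.
rewrite [in X in t * X]/product_sum (big_subsets_setD1 _ (setU11 a _)) (setU1K abY).
rewrite (big_subsets_setD1 _ (setU11 b _)) (setU1K bY) !mulr_sumr /product_sum.
rewrite ?mulr_sumr -!big_split; apply: eq_bigr => C CY /=.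
have inC z : z \in C -> z \in Y := subsetP CY z.
have aC : a \in C = false by apply: contraFF aY; exact: inC.
have bC : b \in C = false by apply: contraNF bY; exact: inC.
rewrite !inE !eqxx aC bC ab ba /= !mul0r add0r addr0.
rewrite !slide_in ?inE ?aX ?(negbTE bX) ?bC ?(negbTE bY) ?andbF //.
have -> : (a |: C) :\ a :\ b = C.
  by apply: (@eq_set_off2 a b) => [||z /negbTE za /negbTE zb];
    rewrite !inE ?eqxx ?za ?zb ?aC ?bC ?andbF.
have -> : (b |: C) :\ a :\ b = C.
  by apply: (@eq_set_off2 a b) => [||z /negbTE za /negbTE zb];
    rewrite !inE ?eqxx ?za ?zb ?aC ?bC ?andbF.
have -> : X :\ a :|: (a |: C) = X :|: C.
  by apply: (@eq_set_off2 a b) => [||z /negbTE za /negbTE zb]; rewrite !inE ?eqxx ?aX ?ba ?za ?orbT.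
have -> : X :\ a :|: (b |: C) = b |: (X :|: C) :\ a.
  by apply: (@eq_set_off2 a b) => [||z /negbTE za /negbTE zb];
    rewrite !inE ?eqxx ?aC ?ab ?ba ?za ?zb ?orbT.
have -> : X :\ a :|: ((a |: (b |: Y)) :\: (a |: C)) = b |: (X :|: (Y :\: C)) :\ a.
  by apply: (@eq_set_off2 a b) => [||z /negbTE za /negbTE zb];
    rewrite !inE ?eqxx ?ab ?ba ?za ?zb ?bC ?orbT.
have -> : X :\ a :|: ((a |: (b |: Y)) :\: (b |: C)) = X :|: (Y :\: C).
  by apply: (@eq_set_off2 a b) => [||z /negbTE za /negbTE zb];
    rewrite !inE ?eqxx ?ab ?ba ?za ?zb ?bC ?aX ?aC ?(negbTE bX) ?(negbTE bY) ?orbT.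
have -> : b |: X :\ a :|: C = b |: (X :|: C) :\ a.
  by apply: (@eq_set_off2 a b) => [||z /negbTE za /negbTE zb];
    rewrite !inE ?eqxx ?ab ?ba ?za ?zb ?bC ?aX ?aC ?(negbTE bX) ?(negbTE bY) ?orbT.
have -> : b |: X :\ a :|: (Y :\: C) = b |: (X :|: (Y :\: C)) :\ a.
  by apply: (@eq_set_off2 a b) => [||z /negbTE za /negbTE zb];
    rewrite !inE ?eqxx ?ab ?ba ?za ?zb ?bC ?aX ?aC ?aY ?(negbTE bX) ?(negbTE bY) ?orbT.
ring.
Qed.

Lemma bichromatic_eq Y f C C' : {in Y, forall y, f y \in Y} ->
  {in Y, C =i C'} -> bichromatic Y f C = bichromatic Y f C'.
Proof.
move=> fY e; apply/bichromaticP/bichromaticP => h y yY; have := h y yY.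
  by rewrite !e ?fY.
by rewrite -!e ?fY.
Qed.

Lemma bichromatic_couple Y f a b C : a \in Y -> b \in Y -> f a = b -> f b = a ->
  bichromatic Y f C = ((a \in C) != (b \in C)) && bichromatic (Y :\ a :\ b) f C.
Proof.
move=> aY bY fa fb; apply/bichromaticP/andP => [h|[ab /bichromaticP h] y yY].
  split; first by have := h a aY; rewrite fa => ->; case: (_ \in _).
  by apply/bichromaticP => y; rewrite !inE => /and3P[_ _]; exact: h.
case: (eqVneq y a) => [->|ya]; first by move: ab; rewrite fa; do 2!case: (_ \in _).
case: (eqVneq y b) => [->|yb]; first by move: ab; rewrite fb; do 2!case: (_ \in _).
by apply: h; rewrite !inE ya yb.
Qed.

(** Two functions are allowed so that the lemma serves both to insert a couple, with
    [g := pairing a b f], and to remove one, with [g := f]. *)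
Lemma matching_sum_couple Y f g d a b : a \in Y -> b \in Y -> a != b ->
  g a = b -> g b = a -> {in Y :\ a :\ b, forall y, f y \in Y :\ a :\ b} ->
  {in Y :\ a :\ b, f =1 g} ->
  matching_sum Y g d = matching_sum (Y :\ a :\ b) f (fun C => d (a |: C) + d (b |: C)).
Proof.
move=> aY bY ab ga gb fY fg; have ba : b == a = false by rewrite eq_sym (negbTE ab).
have bYa : b \in Y :\ a by rewrite !inE ba bY.
rewrite /matching_sum !(big_subsets_setD1 _ aY) !(big_subsets_setD1 _ bYa).
apply: eq_bigr => C CY /=.
have aC : a \in C = false by apply: setD_notin CY _; rewrite !inE eqxx /= andbF.
have bC : b \in C = false by apply: setD_notin CY _; rewrite !inE eqxx.
have gf S : bichromatic (Y :\ a :\ b) g S = bichromatic (Y :\ a :\ b) f S.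
  by apply/bichromaticP/bichromaticP => h y yY; have := h y yY; rewrite fg.
rewrite !(bichromatic_couple _ aY bY ga gb) !gf !inE !eqxx aC bC ba (negbTE ab) /=.
rewrite !mulr0 add0r addr0 mulrDl.
by congr (_ * _ %:R + _ * _%:R); congr nat_of_bool; apply: bichromatic_eq => // y;
  rewrite !inE => /and3P[/negbTE yb /negbTE ya _]; rewrite ?ya ?yb.
Qed.

Lemma matching_sum_tperm Y f d a b :
  matching_sum Y f d =
  matching_sum (tperm a b @: Y) (tperm a b \o f \o tperm a b) (fun C => d (tperm a b @: C)).
Proof.
rewrite [RHS]/matching_sum (reindex_inj (inv_inj (imset_tpermK a b))) /=.
apply: eq_big => C; first by rewrite imset_tpermS.
move=> CY; rewrite imset_tpermK; congr (_ * _ %:R); congr nat_of_bool.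
apply/bichromaticP/bichromaticP => h y.
  by rewrite !mem_imset_tperm /= tpermK => /h.
by move=> yY; have := h (tperm a b y); rewrite !mem_imset_tperm /= !tpermK => ->.
Qed.

Lemma matching_sum_tperm_imset Y f d a b :
  matching_sum (tperm a b @: Y) f (fun C => d (tperm a b @: C)) =
  matching_sum Y (tperm a b \o f \o tperm a b) d.
Proof.
rewrite (matching_sum_tperm _ _ _ a b) imset_tpermK.
by apply: eq_bigr => C _; rewrite imset_tpermK.
Qed.

(** The weight forces [a] and [b] to have opposite colours. If they form a couple, a colouring of
    [Y] extends in two ways; otherwise [f a] and [f b] have opposite colours too, and exactly one
    extension is bichromatic. *)
Lemma matching_sum_contract pos Y f d a b : injective pos -> noncrossing pos (a |: (b |: Y)) f ->
  a \notin Y -> b \notin Y -> a != b -> no_between pos Y a b ->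
  exists g, exists2 k : R, 0 <= k & noncrossing pos Y g /\
  matching_sum (a |: (b |: Y)) f
    (fun C => if (a \in C) != (b \in C) then d (C :\ a :\ b) else 0) = k * matching_sum Y g d.
Proof.
move=> pos_inj nc aY bY ab nb; have [fY fne ff fnc] := nc.
have ba : b == a = false by rewrite eq_sym (negbTE ab).
have aYb : a \notin b |: Y by rewrite !inE (negbTE ab) (negbTE aY).
have YE : (a |: (b |: Y)) :\ a :\ b = Y by rewrite (setU1K aYb) (setU1K bY).
have aY' : a \in a |: (b |: Y) by rewrite !inE eqxx.
have bY' : b \in a |: (b |: Y) by rewrite !inE eqxx orbT.
have dE C : C \subset Y -> 
    [/\ a \in C = false, b \in C = false, (a |: C) :\ a :\ b = C & (b |: C) :\ a :\ b = C].
  move=> /subsetP CY; have aC : a \in C = false by apply: contraNF aY; exact: CY.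
  have bC : b \in C = false by apply: contraNF bY; exact: CY.
  by split=> //; apply: (@eq_set_off2 a b) => [||z /negbTE za /negbTE zb];
    rewrite !inE ?eqxx ?za ?zb ?aC ?bC ?andbF.
have nbY : no_between pos (a |: (b |: Y)) a b.
  by move=> z; rewrite !inE => /or3P[/eqP->|/eqP->|/nb//]; rewrite !ltnn ?andbF.
case: (eqVneq (f a) b) => fab.
  have fb : f b = a by rewrite -fab ff.
  (* The factor 2 counts which of [a] and [b] belongs to [C]. *)
  exists f, 2 => //; split; first by rewrite -YE; exact: noncrossing_remove.
  rewrite (matching_sum_couple (f := f) _ aY' bY' ab fab fb) // YE; last first.
    by have [] := noncrossing_remove nc aY' fab; rewrite YE.
  rewrite /matching_sum mulr_sumr; apply: eq_bigr => C /dE[aC bC Ca Cb].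
  by rewrite !inE !eqxx aC bC ba (negbTE ab) /= Ca Cb; ring.
have ncY := noncrossing_contract pos_inj nc aY' bY' ab fab nbY; rewrite YE in ncY.
exists (contract a b f), 1 => //; split=> //.
rewrite mul1r /matching_sum !(big_subsets_setD1 _ aY') (setU1K aYb).
rewrite !(big_subsets_setD1 _ (setU11 b _)) (setU1K bY).
apply: eq_bigr => C CY; have [aC bC Ca Cb] := dE C CY.
rewrite !inE !eqxx aC bC ba (negbTE ab) /= Ca Cb !mul0r add0r addr0 -mulrDr; congr (_ * _).
have fbY : f b \in Y.
  by have := fY _ bY'; rewrite !inE (negbTE (fne _ bY')) => /or3P[/eqP e||]//;
    rewrite -e ff ?eqxx in fab.
have faY : f a \in Y.
  by have := fY _ aY'; rewrite !inE (negbTE (fne _ aY')) (negbTE fab).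
have uv : f a != f b by apply: contra_neq ab => /(congr1 f); rewrite !ff.
(* [S] is one of the two extensions of [C]; the couple of [b] forces [a] to have the colour of
   [f b]. *)
have both (S : {set T}) : (b \in S) = (a \notin S) -> {in Y, S =i C} ->
    bichromatic (a |: (b |: Y)) f S =
    bichromatic Y (contract a b f) C && ((f b \in C) == (a \in S)).
  move=> bS SC; apply/bichromaticP/andP => [h|[/bichromaticP h /eqP fbS] y].
    have faC : (f a \in C) = (a \notin S) by rewrite -SC // h.
    have fbC : (f b \in C) = (a \in S) by rewrite -SC // h // bS negbK.
    split; last by rewrite fbC.
    apply/bichromaticP => y yY; rewrite /contract.
    case: eqP => [->|/eqP yfa]; first by rewrite faC fbC negbK.
    case: eqP => [->|/eqP yfb]; first by rewrite faC fbC.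
    have yY2 : y \in a |: (b |: Y) by rewrite !inE yY !orbT.
    have fyY : f y \in Y.
      have := fY _ yY2; rewrite !inE => /or3P[/eqP e|/eqP e|//].
        by rewrite -e ff ?eqxx in yfa.
      by rewrite -e ff ?eqxx in yfb.
    by rewrite -!SC // h.
  have faC : (f a \in C) = (a \notin S).
    by have := h _ faY; rewrite /contract eqxx fbS => ->; rewrite negbK.
  rewrite !inE => /or3P[/eqP->|/eqP->|yY]; first by rewrite SC.
    by rewrite SC // fbS bS negbK.
  case: (eqVneq y (f a)) => [->|yfa]; first by rewrite ff // (SC (f a)) // faC negbK.
  case: (eqVneq y (f b)) => [->|yfb]; first by rewrite ff // (SC (f b)) // fbS bS.
  have yY2 : y \in a |: (b |: Y) by rewrite !inE yY !orbT.
  have fyY : f y \in Y.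
    have := fY _ yY2; rewrite !inE => /or3P[/eqP e|/eqP e|//].
      by rewrite -e ff ?eqxx in yfa.
    by rewrite -e ff ?eqxx in yfb.
  by rewrite !SC // -h // /contract (negbTE yfa) (negbTE yfb).
have notab y : y \in Y -> (y == a = false) * (y == b = false).
  by move=> yY; split; apply: contraTF yY => /eqP->.
rewrite !both ?inE ?eqxx ?aC ?bC ?ba ?(negbTE ab) ?orbF //.
- by case: (bichromatic _ _ _); case: (_ \in _); rewrite /= ?addr0 ?add0r.
- by move=> y /notab e; rewrite !inE !e.
- by move=> y /notab e; rewrite !inE !e.
Qed.

End ProductSum.

(** * Positivity against matchings and against products of minors *)

Lemma quad_lead_ge0 (R : realFieldType) (u v w : R) :
  (forall t, 0 <= t -> 0 <= u + t * v + t ^+ 2 * w) -> 0 <= w.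
Proof.
move=> h; rewrite leNgt; apply/negP => w0.
set s := `|u| + `|v|; have s0 : 0 <= s by rewrite addr_ge0.
(* Chosen so that [s + t * w = w]. As [t >= 1], the polynomial at [t] is at most [t * (s + t * w)],
   which is negative. *)
pose t := 1 + s / - w.
have t1 : 1 <= t by rewrite lerDl divr_ge0 // oppr_ge0 ltW.
have tw : s + t * w = w by rewrite /t; field; rewrite lt_eqF.
have := h t (le_trans ler01 t1); rewrite leNgt => /negP; apply.
have hu : u <= t * `|u| by apply: le_trans (ler_norm u) _; rewrite ler_peMl.
have hv : t * v <= t * `|v| by rewrite ler_wpM2l ?ler_norm // (le_trans ler01).
apply: (@le_lt_trans _ _ (t * (s + t * w))); last by rewrite tw pmulr_rlt0 ?(lt_le_trans ltr01).
have -> : t * (s + t * w) = t * `|u| + t * `|v| + t ^+ 2 * w by rewrite /s; ring.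
by rewrite lerD2r lerD.
Qed.

Lemma lin_lead_ge0 (R : realFieldType) (u v : R) :
  (forall t, 0 <= t -> 0 <= u + t * v) -> 0 <= v.
Proof.
move=> h; apply: (@quad_lead_ge0 _ u 0) => t t0; rewrite mulr0 addr0.
by apply: h; rewrite exprn_ge0.
Qed.

Section Cone.
Variables (R : realFieldType) (T : finType) (pos : T -> nat).
Hypothesis pos_inj : injective pos.
Implicit Types (D d : {set T} -> R) (X Y C S : {set T}) (f : T -> T) (a b : T) (t : R).

(** The products of values of [D] lie in the cone dual to the weights with nonnegative matching
    sums. [X] and [Y] are quantified here because a slide changes them. *)
Definition matching_positive D : Prop := forall X Y d, [disjoint X & Y] ->
  (forall f, noncrossing pos Y f -> 0 <= matching_sum Y f d) -> 0 <= product_sum X Y D d.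

(** A zero row gives the first alternative. A zero column gives the second, since [Delta] uses the
    columns outside its argument. *)
Definition negligible D z : Prop :=
  (forall S, z \in S -> D S = 0) \/ (forall S, z \notin S -> D S = 0).

(** Exactly one of the two factors contains [z], so under either alternative one factor vanishes. *)
Lemma negligible_product X Y D d z : [disjoint X & Y] -> negligible D z -> z \in Y ->
  product_sum X Y D d = 0.
Proof.
move=> XY nD zY; apply: big1 => C CY.
have zX : z \notin X by apply/negP => zX; have := disjointFr XY zX; rewrite zY.
case: nD => nD; case: (boolP (z \in C)) => zC.
- by rewrite (nD (X :|: C)) ?mul0r ?mulr0 // inE zC orbT.
- by rewrite (nD (X :|: (Y :\: C))) ?mulr0 // !inE zC zY orbT.
- by rewrite (nD (X :|: (Y :\: C))) ?mulr0 // !inE zC (negbTE zX).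
- by rewrite (nD (X :|: C)) ?mul0r ?mulr0 // inE (negbTE zC) (negbTE zX).
Qed.

Lemma negligible_slide D a b t z : z != a -> z != b -> negligible D z ->
  negligible (slide a b t D) z.
Proof.
move=> za zb [nD|nD]; [left|right] => S zS; rewrite /slide nD //;
  by case: ifP; rewrite ?nD ?mulr0 ?addr0 // !inE (negbTE zb) za.
Qed.

(** Elimination may skip zero rows and columns, so [a] and [b] need not be adjacent. If a skipped
    point is in [Y], all products vanish; otherwise [a] and [b] are adjacent relative to [Y], and
    the positivity of [D] applies to each coefficient of the slide. *)
Lemma matching_positive_slide D a b t : a != b -> 0 <= t ->
  (forall z, (pos a < pos z < pos b)%N || (pos b < pos z < pos a)%N -> negligible D z) ->
  matching_positive D -> matching_positive (slide a b t D).
Proof.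
move=> ab t0 nD pD X Y d XY hd.
have [/existsP[z /andP[zY hz]]|] := boolP
  [exists z, (z \in Y) && ((pos a < pos z < pos b)%N || (pos b < pos z < pos a)%N)].
  rewrite (negligible_product _ XY (z := z)) //; apply: negligible_slide; last exact: nD.
    by apply/eqP => e; move: hz; rewrite e; lia.
  by apply/eqP => e; move: hz; rewrite e; lia.
rewrite negb_exists => /forallP nb0.
have nb : no_between pos Y a b.
  by move=> z zY; have := nb0 z; rewrite zY; lia.
have pX := pD X Y d XY hd.
have [same|] := boolP ((a \notin X :|: Y) || (b \in X)); first by rewrite product_sum_slide_same.
rewrite negb_or negbK inE => /andP[aXY bX].
have dXY z : z \in X -> z \in Y -> False by move=> zX; rewrite (disjointFr XY zX).
have one : (a \in Y) && (b \notin X :|: Y) || (a \in X) && (b \in Y) ->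
    0 <= product_sum X Y (slide a b t D) d.
  move=> h; rewrite product_sum_slide_one // addr_ge0 // mulr_ge0 //; apply: pD.
    by rewrite -setI_eq0 -imsetI ?imset_eq0 ?setI_eq0 //; move=> x y _ _; exact: perm_inj.
  move=> f ncf; rewrite matching_sum_tperm_imset; apply: hd.
  have nbs : no_between pos (tperm a b @: Y) a b.
    move=> z; rewrite mem_imset_tperm; case: tpermP => [-> _|-> _|_ _]; last exact: nb.
      by rewrite !ltnn andbF.
    by rewrite !ltnn andbF.
  rewrite -(imset_tpermK a b Y); case/orP: h => /andP[h1 h2].
    move: h2; rewrite inE negb_or => /andP[_ bY].
    by apply: noncrossing_tperm => //; rewrite mem_imset_tperm ?tpermL ?tpermR.
  have aY : a \notin Y by apply/negP; exact: dXY.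
  rewrite !(tpermC a b) in nbs ncf *; apply: noncrossing_tperm => //;
    rewrite ?mem_imset_tperm ?tpermL ?tpermR //.
  by move=> z zY; rewrite andbC nbs.
case: (boolP (a \in X)) => aX; case: (boolP (b \in Y)) => bY.
- by apply: one; rewrite aX bY orbT.
(* For the mixed term, matchings of [a |: (b |: Y)] are contracted to matchings of [Y]. *)
- rewrite product_sum_slide_left ?inE ?negb_or ?bX //.
  have aY : a \notin Y by rewrite (disjointFr XY aX).
  have dXY1 : [disjoint X :\ a & a |: (b |: Y)].
    apply/pred0P => z /=; rewrite !inE; apply/negP => /andP[/andP[za zX]].
    rewrite (negbTE za) /= => /orP[/eqP e|]; last exact: dXY.
    by rewrite -e zX in bX.
  have dXY2 : [disjoint b |: X :\ a & Y].
    apply/pred0P => z /=; rewrite !inE; apply/negP => /andP[/orP[/eqP->|/andP[_]]].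
      by rewrite (negbTE bY).
    exact: dXY.
  rewrite !addr_ge0 ?mulr_ge0 ?exprn_ge0 //; last exact: pD.
  apply: pD => // f ncf.
  have [g [k k0 [ncg ->]]] := matching_sum_contract d pos_inj ncf aY bY ab nb.
  by rewrite mulr_ge0 ?hd.
- have aY : a \in Y by rewrite (negbTE aX) in aXY.
  have ba : b == a = false by rewrite eq_sym (negbTE ab).
  rewrite product_sum_slide_both // addr_ge0 // mulr_ge0 //; apply: pD.
    apply/pred0P => z /=; rewrite !inE; apply/negP => /andP[/orP[/eqP->|]].
      by rewrite eqxx.
    by move=> zX /and3P[_ _]; exact: dXY.
  move=> f ncf.
  have Y0a : a \notin Y :\ a :\ b by rewrite !inE eqxx andbF.
  have Y0b : b \notin Y :\ a :\ b by rewrite !inE eqxx.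
  have YE : a |: (b |: (Y :\ a :\ b)) = Y by rewrite setD1K ?setD1K // !inE ba bY.
  (* A matching of the smaller set becomes one of [Y] by inserting the couple of [a] and [b]. *)
  have ncg : noncrossing pos Y (pairing a b f).
    rewrite -YE; apply: noncrossing_cup => // z; rewrite !inE => /and3P[_ _]; exact: nb.
  rewrite -(matching_sum_couple (g := pairing a b f)) ?hd //.
  + by rewrite /pairing eqxx.
  + by rewrite /pairing ba eqxx.
  + by case: ncf.
  + by move=> z; rewrite !inE => /and3P[/negbTE zb /negbTE za _]; rewrite /pairing za zb.
- by apply: one; rewrite !inE (negbTE bX) (negbTE bY); move: aXY; rewrite (negbTE aX) /= => ->.
Qed.

(** * Matching sums as iterated leading coefficients *)

Variables (G : ({set T} -> R) -> Prop) (m : nat) (D0 : {set T} -> R).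
Definition slide_closed a b : Prop := forall D t, G D -> 0 <= t -> G (slide a b t D).
Hypothesis slide_up : forall a b, pos b = (pos a).+1 -> slide_closed a b.
(* No slide from position [m] to [m.-1]: it would not correspond to a matrix operation
   when [m] is the junction of the two halves of the circle. *)
Hypothesis slide_down : forall a b, pos a = (pos b).+1 -> pos a <> m -> slide_closed a b.
Hypothesis pos_succ : forall a b, (pos a < pos b)%N -> exists c, pos c = (pos a).+1.
Hypothesis pos_pred : forall a b, (pos a < pos b)%N -> exists c, pos b = (pos c).+1.
(** In the application [m] is the number of rows, so that [S0] is the upper half, which indexes the
    empty minor; [D0] comes from the zero matrix, whose empty minor is 1. *)
Let S0 := [set z | (m <= pos z)%N].
Hypothesis GD0 : G D0.
Hypothesis D0S0 : D0 S0 != 0.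

Definition product_positive X Y d : Prop := forall D, G D -> 0 <= product_sum X Y D d.

Lemma product_sum0 X D d : product_sum X set0 D d = d set0 * D X ^+ 2.
Proof.
rewrite /product_sum (big_pred1 set0) => [|C]; last by rewrite subset0.
by rewrite setD0 !setU0 expr2.
Qed.

Lemma matching_sum0 f d : matching_sum set0 f d = d set0.
Proof.
rewrite /matching_sum (big_pred1 set0) => [|C]; last by rewrite subset0.
suff -> : bichromatic set0 f set0 by rewrite mulr1.
by apply/bichromaticP => y; rewrite inE.
Qed.

(** Some element of [X] lies below a point [z] of [S0] missing from [X]. The highest element of [X]
    below [z] is followed by a point outside [X]. *)
Lemma gap_step X : #|X| = #|S0| -> X != S0 ->
  exists a b, [/\ a \in X, b \notin X & pos b = (pos a).+1].
Proof.
move=> cX neX.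
have /subsetPn[z zS zX] : ~~ (S0 \subset X).
  by apply: contra neX => sub; rewrite eq_sym eqEcard sub cX /=.
have /subsetPn[y yX yS] : ~~ (X \subset S0).
  by apply: contra neX => sub; rewrite eqEcard sub cX /=.
have yz : (pos y < pos z)%N by move: zS yS; rewrite !inE; lia.
case: (arg_maxnP (P := fun a => (a \in X) && (pos a < pos z)%N) pos (i0 := y)).
  by rewrite yX.
move=> a /andP[aX az] max; have [b bE] := pos_succ az.
exists a, b; split=> //; apply/negP => bX.
have : pos b <> pos z by move/pos_inj => e; rewrite -e bX in zX.
have := max b; rewrite bX bE /=; move: yz bE az; clear; lia.
Qed.

(** Elements of [X] slide up one place at a time until [X] is [S0], where [D0] is nonzero. The
    coefficient of [t ^+ 2] passes positivity on at each step, and the sum of the positions in [X]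
    bounds the number of steps. *)
Lemma product_positive_set0 X d : #|X| = #|S0| -> product_positive X set0 d -> 0 <= d set0.
Proof.
move: {2}(\sum_z pos z - \sum_(z in X) pos z)%N (leqnn (\sum_z pos z - \sum_(z in X) pos z)) => k.
elim: k X d => [|k IH] X d hk cX pX; have [XS|neX] := eqVneq X S0;
  try (by have := pX _ GD0; rewrite product_sum0 XS pmulr_lge0 // exprn_even_gt0);
  have [a [b [aX bX ab]]] := gap_step cX neX;
  have neb : b != a by apply: contraNneq bX => ->.
all: have WE : (\sum_(z in b |: X :\ a) pos z = (\sum_(z in X) pos z).+1)%N by
  rewrite big_setU1 ?inE ?negb_and ?(negbTE bX) ?orbT //= (big_setD1 a aX) /= ab.
all: have le : (\sum_(z in b |: X :\ a) pos z <= \sum_z pos z)%N by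
  rewrite [leqRHS](bigID (mem (b |: X :\ a))) /= leq_addr.
  by exfalso; lia.
apply: (IH (b |: X :\ a)); first by lia.
  by rewrite cardsU1 !inE (negbTE bX) andbF -cX (cardsD1 a X) aX.
move=> D GD; apply: (@quad_lead_ge0 _ (product_sum X set0 D d)
  (product_sum (X :\ a) (a |: (b |: set0)) D
          (fun C => if (a \in C) != (b \in C) then d (C :\ a :\ b) else 0))) => t t0.
rewrite -product_sum_slide_left ?inE ?(negbTE bX) // -?setI_eq0 ?setI0 //.
by apply: pX; exact: slide_up.
Qed.

(** The coefficient of [t] carries the element [x] of [Y] to the place [c]. The slide goes from [c]
    to [x] if [c] is in [X] and from [x] to [c] otherwise, hence the two closure hypotheses. *)
Lemma product_positive_move X Y d x c : [disjoint X & Y] -> x \in Y -> c \notin Y ->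
  slide_closed x c -> slide_closed c x -> product_positive X Y d ->
  product_positive (tperm c x @: X) (tperm c x @: Y) (fun C => d (tperm c x @: C)).
Proof.
move=> XY xY cY xc cx pX D GD.
have neq : c != x by apply: contraNneq cY => ->.
apply: (@lin_lead_ge0 _ (product_sum X Y D d)) => t t0.
have [cX|cX] := boolP (c \in X).
  by rewrite -product_sum_slide_one ?cX ?xY ?orbT //; apply: pX; exact: cx.
rewrite tpermC -product_sum_slide_one ?inE ?(negbTE cX) ?cY ?xY //; last by rewrite eq_sym.
by apply: pX; exact: xc.
Qed.

Lemma disjoint_tperm X Y a b : [disjoint X & Y] ->
  [disjoint tperm a b @: X & tperm a b @: Y].
Proof.
move=> XY; rewrite -setI_eq0 -imsetI ?imset_eq0 ?setI_eq0 //.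
by move=> x y _ _; exact: perm_inj.
Qed.

(** Induction on the size of [Y], and within it on the span of an innermost couple. Adjacent ends
    are removed by the leading coefficient of a slide; otherwise one end is moved a place towards
    the other. The balance condition is preserved and gives [X] the size of [S0] once [Y] is
    empty. *)
Lemma product_positive_matching X Y f d : [disjoint X & Y] -> noncrossing pos Y f ->
  (#|X|.*2 + #|Y| = #|S0|.*2)%N -> product_positive X Y d -> 0 <= matching_sum Y f d.
Proof.
move: {2}#|Y| (leqnn #|Y|) => k.
elim: k X Y f d => [|k IH] X Y f d cY XY nc bal pX.
  have Y0 : Y = set0 by apply/eqP; rewrite -cards_eq0 -leqn0.
  rewrite Y0 matching_sum0; apply: (@product_positive_set0 X); last by rewrite -Y0.
  by move: bal; rewrite Y0 cards0; lia.
have [Y0|Yn0] := eqVneq Y set0.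
  rewrite Y0 matching_sum0; apply: (@product_positive_set0 X); last by rewrite -Y0.
  by move: bal; rewrite Y0 cards0; lia.
have [a [aY lta nb]] := noncrossing_innermost pos_inj nc Yn0.
move: {2}(pos (f a) - pos a)%N (leqnn (pos (f a) - pos a)) => g.
elim: g X Y f d a cY XY nc bal pX Yn0 aY lta nb => [|g IHg] X Y f d a
  cY XY nc bal pX Yn0 aY lta nb hg.
  by lia.
have [fY fne ff _] := nc; have bY := fY a aY; have ba := fne a aY.
have ab : a != f a by rewrite eq_sym.
have [adj|nadj] := eqVneq (pos (f a)) (pos a).+1.
  rewrite (matching_sum_couple (f := f) _ aY bY ab) ?ff //; last first.
    by have [] := noncrossing_remove nc aY erefl.
  have aX : a \notin X by apply/negP => aX; have := disjointFr XY aX; rewrite aY.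
  have bX : f a \notin X by apply/negP => bX; have := disjointFr XY bX; rewrite bY.
  have cYE : #|Y| = (#|Y :\ a :\ f a|).+2.
    by rewrite (cardsD1 a) aY (cardsD1 (f a) (Y :\ a)) !inE ba bY.
  apply: (IH (f a |: X)); [by move: cY cYE; clear; lia| |exact: noncrossing_remove| |].
  - apply/pred0P => z /=; rewrite !inE; apply/negP => /andP[/orP[/eqP->|]].
      by rewrite eqxx.
    by move=> zX; rewrite (disjointFr XY zX) !andbF.
  - by rewrite cardsU1 bX -bal cYE; clear; lia.
  - move=> D GD; apply: (@lin_lead_ge0 _ (product_sum X Y D d)) => t t0.
    by rewrite -product_sum_slide_both //; apply: pX; exact: slide_up.
have card_s (c x : T) (Z : {set T}) : #|tperm c x @: Z| = #|Z|.
  by rewrite card_imset //; exact: perm_inj.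
have Sne (c x : T) (Z : {set T}) : Z != set0 -> tperm c x @: Z != set0.
  by rewrite imset_eq0.
have btw c : (pos a < pos c < pos (f a))%N -> [/\ c \notin Y, c != a & c != f a].
  move=> hc; split; last 2 first.
  - by apply/eqP => e; move: hc; rewrite e; lia.
  - by apply/eqP => e; move: hc; rewrite e; lia.
  by apply/negP => cY'; have := nb _ cY'; rewrite hc.
(* Moving [a] up to position [m] would call for the excluded slide from [m] to [m.-1]. In that case
   the other end moves down; it is not at [m], since the ends are not adjacent. *)
have [am|am] := eqVneq (pos a).+1 m.
  have [c cE] := pos_pred lta.
  have hc : (pos a < pos c < pos (f a))%N by lia.
  have [cY' ca cb] := btw _ hc.
  have ac : a != c by rewrite eq_sym.
  rewrite (matching_sum_tperm _ _ _ c (f a)).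
  have fa' : (tperm c (f a) \o f \o tperm c (f a)) a = c.
    by rewrite /= (tpermD ca ba) tpermR.
  apply: (IHg (tperm c (f a) @: X) _ _ _ a); rewrite ?card_s ?fa' ?Sne //;
    last by move: hg hc cE lta; clear; lia.
  - exact: disjoint_tperm.
  - apply: noncrossing_tperm => //; move=> z zY.
    by move: cE; clear; lia.
  - apply: product_positive_move => //; first by apply: slide_down => //; move: am nadj; clear; lia.
    exact: slide_up.
  - by rewrite mem_imset_tperm tpermD.
  - by move: hc; clear; lia.
  - move=> z; rewrite mem_imset_tperm; case: tpermP => [->|->|]; rewrite ?ltnn ?andbF //.
      by move: hc; clear; lia.
    by move=> zc zb /nb; move: hc cE; clear; lia.
have [c cE] := pos_succ lta.
have hc : (pos a < pos c < pos (f a))%N by lia.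
have [cY' ca cb] := btw _ hc.
have ac : a != c by rewrite eq_sym.
rewrite (matching_sum_tperm _ _ _ c a).
have fa' : (tperm c a \o f \o tperm c a) c = f a.
  by rewrite /= tpermL tpermD // eq_sym.
apply: (IHg (tperm c a @: X) _ _ _ c); rewrite ?card_s ?fa' ?Sne //;
    last by move: hg hc cE lta; clear; lia.
- exact: disjoint_tperm.
- apply: noncrossing_tperm => // z zY; move: cE; clear; lia.
- apply: product_positive_move => //; first exact: slide_up.
  by apply: slide_down => //; apply/eqP; rewrite cE.
- by rewrite mem_imset_tperm tpermL.
- by move: hc; clear; lia.
- move=> z; rewrite mem_imset_tperm; case: tpermP => [->|->|]; rewrite ?ltnn ?andbF //.
    by move: hc; clear; lia.
  by move=> zc zb /nb; move: hc cE; clear; lia.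
Qed.
End Cone.

(** * Minors and increasing index maps *)

Definition increasing (k n : nat) (f : 'I_k -> 'I_n) : Prop :=
  forall x y : 'I_k, (x < y)%N -> (f x < f y)%N.

Definition upd (k n : nat) (f : 'I_k -> 'I_n) (p : 'I_k) (h : 'I_n) (x : 'I_k) : 'I_n :=
  if x == p then h else f x.

Lemma sorted_enum_ord n : sorted (fun x y : 'I_n => (x < y)%N) (enum 'I_n).
Proof. by have := iota_ltn_sorted 0 n; rewrite -val_enum_ord sorted_map. Qed.

Section Increasing.
Variables (k n : nat).
Implicit Types (f : 'I_k -> 'I_n) (I : {set 'I_n}).

Lemma increasing_inj f : increasing f -> injective f.
Proof.
move=> incf x y fxy; apply/val_inj/eqP; case: ltngtP => // h; have := incf _ _ h;
  by rewrite fxy ltnn.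
Qed.

Lemma card_increasing f : increasing f -> #|f @: 'I_k| = k.
Proof. by move=> /increasing_inj inj; rewrite card_imset // card_ord. Qed.

Lemma sorted_enum_set I : sorted (fun x y : 'I_n => (x < y)%N) (enum I).
Proof.
rewrite /(enum _); apply: sorted_filter; first by move=> y x z; exact: ltn_trans.
by rewrite -enumT; exact: sorted_enum_ord.
Qed.

Lemma enum_imset_increasing f : increasing f -> enum (f @: 'I_k) = map f (enum 'I_k).
Proof.
move=> incf; apply: (irr_sorted_eq (leT := fun x y : 'I_n => (x < y)%N)).
- by move=> y x z; exact: ltn_trans.
- by move=> x; rewrite /= ltnn.
- exact: sorted_enum_set.
- rewrite sorted_map; apply: (@sub_sorted _ (fun x y : 'I_k => (x < y)%N)).
    by move=> x y; exact: incf.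
  exact: sorted_enum_ord.
move=> x; rewrite mem_enum; apply/imsetP/mapP => -[y _ ->]; exists y => //.
by rewrite mem_enum.
Qed.

Lemma enum_val_increasing f (e : #|f @: 'I_k| = k) (i : 'I_#|f @: 'I_k|) :
  increasing f -> enum_val i = f (cast_ord e i).
Proof.
move=> incf; have ik : (i < k)%N := leq_trans (ltn_ord i) (eq_leq e).
have x0 : 'I_k := Ordinal ik.
rewrite (enum_val_nth (f x0)) enum_imset_increasing // (nth_map x0) ?size_enum_ord //.
by congr f; apply: val_inj; rewrite /= nth_enum_ord.
Qed.

End Increasing.

Lemma increasing_enum_val (n : nat) (I : {set 'I_n}) :
  increasing (fun x : 'I_#|I| => enum_val x).
Proof.
move=> x y xy; have n0 : 'I_n := enum_val x.
rewrite !(enum_val_nth n0).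
apply: (sorted_ltn_nth (leT := fun x y : 'I_n => (x < y)%N)) => //.
- by move=> a b c; exact: ltn_trans.
- exact: sorted_enum_set.
- by rewrite inE -cardE.
- by rewrite inE -cardE.
Qed.

Lemma imset_enum_val (n k : nat) (I : {set 'I_n}) (e : k = #|I|) :
  (fun x : 'I_k => enum_val (cast_ord e x)) @: 'I_k = I.
Proof.
apply/setP=> z; apply/imsetP/idP => [[x _ ->]|zI]; first exact: enum_valP.
exists (cast_ord (esym e) (enum_rank_in zI z)) => //.
by rewrite cast_ordKV enum_rankK_in.
Qed.

Lemma minor_card_neq (R : comNzRingType) (n n' : nat) (Q : 'M[R]_(n, n'))
  (I : {set 'I_n}) (J : {set 'I_n'}) : #|I| != #|J| -> minor Q I J = 0.
Proof. by rewrite /minor; case: eqP. Qed.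

Section Minor.
Variables (R : comNzRingType) (n n' : nat).
Implicit Types (Q : 'M[R]_(n, n')) (I : {set 'I_n}) (J : {set 'I_n'}).

(** Any increasing parametrization of the index sets computes the minor; this disposes of [enum_val]
    and of the cast in the definition. *)
Lemma minor_increasing k (f : 'I_k -> 'I_n) (g : 'I_k -> 'I_n') Q :
  increasing f -> increasing g -> minor Q (f @: 'I_k) (g @: 'I_k) = \det (mxsub f g Q).
Proof.
move=> incf incg; rewrite /minor; have eI := card_increasing incf.
have eJ := card_increasing incg.
case: eqP => [e|]; last by rewrite eI eJ.
have -> : \matrix_(i, j) Q (enum_val i) (enum_val (cast_ord e j)) =
   \matrix_(i < #|f @: 'I_k|, j < #|f @: 'I_k|) Q (f (cast_ord eI i)) (g (cast_ord eI j)).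
  apply/matrixP=> i j; rewrite !mxE (enum_val_increasing eI) // (enum_val_increasing eJ) //.
  by congr (Q _ (g _)); apply: val_inj.
move: {e eJ} (#|f @: 'I_k|) eI => N eI; case: k / eI in f g incf incg *.
by congr (\det _); apply/matrixP=> i j; rewrite !mxE !cast_ord_id.
Qed.

Lemma increasing_param I J : #|I| = #|J| -> exists k (f : 'I_k -> 'I_n) (g : 'I_k -> 'I_n'),
  [/\ increasing f, increasing g, I = f @: 'I_k & J = g @: 'I_k].
Proof.
move=> e; exists #|I|, (fun x => enum_val (cast_ord erefl x)), (fun x => enum_val (cast_ord e x)).
split; rewrite ?imset_enum_val // => x y xy; exact: increasing_enum_val.
Qed.

Lemma det_row0 k (A : 'M[R]_k) i : (forall j, A i j = 0) -> \det A = 0.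
Proof. by move=> h; rewrite (expand_det_row _ i) big1 // => j _; rewrite h mul0r. Qed.

Lemma minor_row0 Q I J i : i \in I -> (forall j, Q i j = 0) -> minor Q I J = 0.
Proof.
move=> iI Qi; have [e|e] := eqVneq #|I| #|J|; last by rewrite minor_card_neq.
have [k [f [g [incf incg fI gJ]]]] := increasing_param e.
move: iI; rewrite fI gJ minor_increasing // => /imsetP[p _ ip].
by apply: (@det_row0 _ _ p) => j; rewrite mxE -ip.
Qed.

End Minor.

(** * Minors under elementary row, column and corner operations *)

Section MinorRowAdd.
Variables (R : comNzRingType) (n n' : nat).
Implicit Types (Q : 'M[R]_(n, n')) (I : {set 'I_n}) (J : {set 'I_n'}).

Lemma minor_tr Q I J : minor Q^T J I = minor Q I J.
Proof.
have [e|e] := eqVneq #|I| #|J|; last by rewrite (minor_card_neq Q^T) ?minor_card_neq // eq_sym.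
have [k [f [g [incf incg -> ->]]]] := increasing_param e.
rewrite !minor_increasing // -det_tr; congr (\det _).
by apply/matrixP=> i j; rewrite !mxE.
Qed.

Lemma minor_col0 Q I J j : j \in J -> (forall i, Q i j = 0) -> minor Q I J = 0.
Proof. by move=> jJ Qj; rewrite -minor_tr (@minor_row0 _ _ _ Q^T J I j) // => i; rewrite mxE. Qed.

Definition row_add i h t Q : 'M[R]_(n, n') :=
  \matrix_(a, b) (Q a b + (if a == i then t * Q h b else 0)).

Lemma det_row_add k (f : 'I_k -> 'I_n) (g : 'I_k -> 'I_n') Q p h t : injective f ->
  \det (mxsub f g (row_add (f p) h t Q)) =
  \det (mxsub f g Q) + t * \det (mxsub (upd f p h) g Q).
Proof.
move=> inj; rewrite -[X in X + _]mul1r; apply: (determinant_multilinear (i0 := p)).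
- by apply/rowP=> j; rewrite !mxE /upd !eqxx mul1r.
- apply/matrixP=> i j; rewrite !mxE (inj_eq inj) [lift p i == p]eq_sym.
  by rewrite (negbTE (neq_lift p i)) addr0.
- apply/matrixP=> i j; rewrite !mxE (inj_eq inj) /upd [lift p i == p]eq_sym.
  by rewrite (negbTE (neq_lift p i)) addr0.
Qed.

Lemma upd_increasing k (f : 'I_k -> 'I_n) p (h : 'I_n) : increasing f ->
  (forall x, x != p -> (f x < f p -> f x < h) /\ (f p < f x -> h < f x))%N ->
  increasing (upd f p h).
Proof.
move=> incf H x y xy; rewrite /upd; case: eqP => [xp|/eqP xp]; case: eqP => [yp|/eqP yp].
- by move: xy; rewrite xp yp ltnn.
- by have [_] := H _ yp; apply; apply: incf; rewrite -xp.
- by have [] := H _ xp; rewrite -yp => + _; apply; apply: incf.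
- exact: incf.
Qed.

Lemma imset_upd k (f : 'I_k -> 'I_n) p h : injective f ->
  upd f p h @: 'I_k = h |: (f @: 'I_k) :\ f p.
Proof.
move=> inj; apply/setP=> z; rewrite !inE; apply/imsetP/orP.
  move=> [x _ ->]; rewrite /upd; case: (eqVneq x p) => [_|xp]; first by left.
  by right; rewrite (inj_eq inj) xp imset_f.
case=> [/eqP->|/andP[zp /imsetP[x _ zx]]]; first by exists p => //; rewrite /upd eqxx.
exists x => //; rewrite /upd; case: eqP => // xp; by rewrite zx xp eqxx in zp.
Qed.

(** By multilinearity the extra term is the minor with row [i] replaced by row [h]. It has a
    repeated row if [h] is in [I], and a zero row if a row of [I] lies between; otherwise the
    replacement keeps the rows in order and no sign appears. *)
Lemma minor_row_add Q I J (i h : 'I_n) t : i != h ->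
  (forall r : 'I_n, (i < r < h)%N || (h < r < i)%N -> forall j, Q r j = 0) ->
  minor (row_add i h t Q) I J =
  minor Q I J + t * (if (i \in I) && (h \notin I) then minor Q (h |: I :\ i) J else 0).
Proof.
move=> ih btw; have [e|e] := eqVneq #|I| #|J|; last first.
  rewrite (minor_card_neq _ e) (minor_card_neq Q e) add0r.
  case: ifP => [/andP[iI hI]|_]; last by rewrite mulr0.
  rewrite minor_card_neq ?mulr0 // cardsU1 !inE (negbTE hI) andbF.
  by rewrite (cardsD1 i I) iI in e.
have [k [f [g [incf incg fI gJ]]]] := increasing_param e.
have injf := increasing_inj incf.
have [iI|iI] := boolP (i \in I); last first.
  rewrite mulr0 addr0 fI gJ !minor_increasing //; congr (\det _).
  apply/matrixP=> x y; rewrite !mxE; case: eqP => [xi|_]; last by rewrite addr0.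
  by rewrite fI -xi imset_f in iI.
move: (iI); rewrite fI => /imsetP[p _ ip].
rewrite gJ !minor_increasing // ip det_row_add // -ip; congr (_ + t * _).
have [hI|hI] := boolP (h \in f @: 'I_k) => /=.
  move: hI => /imsetP[q _ hq]; have qp : q != p by apply: contra_neq ih => e'; rewrite ip hq e'.
  rewrite (determinant_alternate (i1 := p) (i2 := q)) 1?eq_sym // => j.
  by rewrite !mxE /upd eqxx (negbTE qp) hq.
have [/existsP[x hx]|nx] := boolP [exists x, (i < f x < h)%N || (h < f x < i)%N].
  have xp : x != p by apply/eqP => xp; move: hx; rewrite xp -ip; lia.
  rewrite (@det_row0 _ _ _ x); last by move=> j; rewrite !mxE /upd (negbTE xp) btw.
  rewrite (@minor_row0 _ _ _ _ _ _ (f x)) // ?inE ?ip ?(inj_eq injf) ?xp ?imset_f ?orbT //.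
  exact: btw.
move: nx; rewrite negb_exists => /forallP nx.
have incu : increasing (upd f p h).
  apply: upd_increasing => // x xp; rewrite -ip; have := nx x.
  have : nat_of_ord (f x) <> h by move=> /val_inj e'; rewrite -e' imset_f in hI.
  clear; lia.
by rewrite ip -imset_upd // minor_increasing.
Qed.

End MinorRowAdd.

Definition col_add (R : comNzRingType) (n n' : nat) (j h : 'I_n') t (Q : 'M[R]_(n, n')) :=
  (row_add j h t Q^T)^T.

Definition corner_add (R : comNzRingType) (n n' : nat) (i : 'I_n) (k : 'I_n') t
    (Q : 'M[R]_(n, n')) : 'M[R]_(n, n') :=
  \matrix_(a, b) (Q a b + (if (a == i) && (b == k) then t else 0)).

Lemma increasing_lift n m (f : 'I_m.+1 -> 'I_n) q : increasing f -> increasing (f \o lift q).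
Proof.
move=> incf x y xy; apply: incf; rewrite /= /bump; move: xy.
by case: (leqP q x); case: (leqP q y) => /=; lia.
Qed.

Lemma imset_lift m (T : finType) (f : 'I_m.+1 -> T) q : injective f ->
  (f \o lift q) @: 'I_m = (f @: 'I_m.+1) :\ f q.
Proof.
move=> inj; apply/setP=> z; rewrite !inE; apply/imsetP/andP.
  move=> [x _ ->] /=; split; last by rewrite imset_f.
  by rewrite (inj_eq inj) eq_sym neq_lift.
move=> [zq /imsetP[x _ zx]]; have xq : q != x by apply: contraNneq zq => ->; rewrite zx.
by have [y xy] := unlift_some xq; exists y; rewrite // zx xy.
Qed.

Section Corner.
Variables (R : comNzRingType) (n n' : nat).
Implicit Types (Q : 'M[R]_(n, n')) (I : {set 'I_n}) (J : {set 'I_n'}).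

Lemma minor_col_add Q I J (j h : 'I_n') t : j != h ->
  (forall c : 'I_n', (j < c < h)%N || (h < c < j)%N -> forall i, Q i c = 0) ->
  minor (col_add j h t Q) I J =
  minor Q I J + t * (if (j \in J) && (h \notin J) then minor Q I (h |: J :\ j) else 0).
Proof.
move=> jh btw; rewrite /col_add minor_tr minor_row_add ?minor_tr //.
by move=> r hr i; rewrite mxE btw.
Qed.

(** If [i] is not the last row of [I], or [k] not the last column of [J], a zero row or column kills
    all minors involved. If both are last, the cofactor of the changed entry has sign [+]. *)
Lemma minor_corner_add Q I J (i : 'I_n) (k : 'I_n') t :
  (forall r : 'I_n, (i < r)%N -> forall j, Q r j = 0) ->
  (forall c : 'I_n', (k < c)%N -> forall r, Q r c = 0) ->
  minor (corner_add i k t Q) I J =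
  minor Q I J + t * (if (i \in I) && (k \in J) then minor Q (I :\ i) (J :\ k) else 0).
Proof.
move=> row0 col0; have [e|e] := eqVneq #|I| #|J|; last first.
  rewrite (minor_card_neq _ e) (minor_card_neq Q e) add0r.
  case: ifP => [/andP[iI kJ]|_]; last by rewrite mulr0.
  rewrite minor_card_neq ?mulr0 //.
  by rewrite (cardsD1 i I) iI (cardsD1 k J) kJ in e.
have [m [f [g [incf incg fI gJ]]]] := increasing_param e.
have injf := increasing_inj incf; have injg := increasing_inj incg.
case: ifPn => [/andP[iI kJ]|]; last first.
  rewrite negb_and => h; rewrite mulr0 addr0 fI gJ !minor_increasing //; congr (\det _).
  apply/matrixP=> x y; rewrite !mxE; case: eqP => [xi|_]; case: eqP => [yk|_]; rewrite ?addr0 //.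
  by move: h; rewrite -xi -yk fI gJ !imset_f.
move: (iI) (kJ); rewrite fI gJ => /imsetP[p _ ip] /imsetP[q _ kq].
case: m f g incf incg fI gJ injf injg p q ip kq => [|m] f g incf incg fI gJ injf injg p q ip kq.
  by case: p ip.
have [pm|pm] := eqVneq p ord_max; last first.
  have lt : (p < @ord_max m)%N by rewrite ltn_neqAle -ltnS ltn_ord andbT.
  have lt' := incf _ _ lt; rewrite -ip in lt'.
  have fm : f ord_max \in (f @: 'I_m.+1) :\ i.
    by rewrite !inE imset_f // andbT; apply/eqP => e'; rewrite e' ltnn in lt'.
  have fm' : f ord_max \in (f @: 'I_m.+1) by rewrite imset_f.
  rewrite (minor_row0 _ fm (row0 _ lt')) (minor_row0 _ fm' (row0 _ lt')) mulr0 addr0.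
  rewrite (minor_row0 _ fm') // => j; rewrite mxE row0 // add0r.
  by case: eqP => // e'; rewrite e' ltnn in lt'.
have [qm|qm] := eqVneq q ord_max; last first.
  have lt : (q < @ord_max m)%N by rewrite ltn_neqAle -ltnS ltn_ord andbT.
  have lt' := incg _ _ lt; rewrite -kq in lt'.
  have gm : g ord_max \in (g @: 'I_m.+1) :\ k.
    by rewrite !inE imset_f // andbT; apply/eqP => e'; rewrite e' ltnn in lt'.
  have gm' : g ord_max \in (g @: 'I_m.+1) by rewrite imset_f.
  rewrite (minor_col0 _ gm (col0 _ lt')) (minor_col0 _ gm' (col0 _ lt')) mulr0 addr0.
  rewrite (minor_col0 _ gm') // => j; rewrite mxE col0 // add0r.
  by case: (g ord_max =P k) => [e'|]; rewrite ?andbF //; rewrite e' ltnn in lt'.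
rewrite ip kq -!imset_lift // !minor_increasing //; try exact: increasing_lift.
rewrite !(expand_det_row _ p) (bigD1 q) //= [X in _ = X + _](bigD1 q) //=.
have cof j : cofactor (mxsub f g (corner_add (f p) (g q) t Q)) p j = cofactor (mxsub f g Q) p j.
  rewrite /cofactor; congr (_ * \det _); apply/matrixP=> x y; rewrite !mxE (inj_eq injf).
  by rewrite [lift p x == p]eq_sym (negbTE (neq_lift p x)) addr0.
rewrite (eq_bigr (fun j => mxsub f g Q p j * cofactor (mxsub f g Q) p j)) => [|j jq]; last first.
  by rewrite cof !mxE (inj_eq injg) (negbTE jq) andbF addr0.
rewrite cof !mxE !eqxx /= mulrDl addrAC; congr (_ + _ + t * _).
rewrite /cofactor pm qm -signr_odd oddD addbb mul1r; congr (\det _).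
by apply/matrixP=> x y; rewrite !mxE.
Qed.

End Corner.

(** * Minors indexed by sets of circle points *)

Section Delta.
Variables (R : realType) (n n' : nat).
Implicit Types (Q : 'M[R]_(n, n')) (S : {set point n n'}) (t : R).

(** Only sets with [n'] elements ask for a square minor; on all others the default value of [minor]
    makes this 0. *)
Definition Delta Q S : R := minor Q [set i | inl i \in S] [set j | inr j \notin S].

Lemma sum_eqE (A B : eqType) :
  ((forall i j : A, (inl i == inl j :> A + B) = (i == j)) *
  (forall i j : B, (inr i == inr j :> A + B) = (i == j)) *
  (forall (i : A) (j : B), (inl i == inr j :> A + B) = false) *
  (forall (i : A) (j : B), (inr j == inl i :> A + B) = false))%type.
Proof. by []. Qed.

Lemma Delta_row_add Q (i h : 'I_n) t S : i != h ->
  (forall r : 'I_n, (i < r < h)%N || (h < r < i)%N -> forall j, Q r j = 0) ->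
  Delta (row_add i h t Q) S = slide (inl i) (inl h) t (Delta Q) S.
Proof.
move=> ih btw; rewrite /Delta minor_row_add // /slide !inE; congr (_ + t * _).
case: ifP => // _; congr (minor Q _ _); apply/setP=> x; rewrite !inE !sum_eqE //=.
Qed.

(** The upper points of [S] are the columns left out, so adding column [h] to column [j] slides from
    [h] to [j], against the direction found for rows. *)
Lemma Delta_col_add Q (j h : 'I_n') t S : j != h ->
  (forall c : 'I_n', (j < c < h)%N || (h < c < j)%N -> forall i, Q i c = 0) ->
  Delta (col_add j h t Q) S = slide (inr h) (inr j) t (Delta Q) S.
Proof.
move=> jh btw; rewrite /Delta minor_col_add // /slide !inE negbK andbC; congr (_ + t * _).
case: ifP => // /andP[hS jS]; congr (minor Q _ _); apply/setP=> x; rewrite !inE !sum_eqE //=.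
rewrite negb_or negb_and negbK.
case: (eqVneq x h) => [->|xh] //=; by rewrite eq_sym (negbTE jh).
Qed.

Lemma Delta_corner_add Q (i : 'I_n) (k : 'I_n') t S :
  (forall r : 'I_n, (i < r)%N -> forall j, Q r j = 0) ->
  (forall c : 'I_n', (k < c)%N -> forall r, Q r c = 0) ->
  Delta (corner_add i k t Q) S = slide (inl i) (inr k) t (Delta Q) S.
Proof.
move=> h1 h2; rewrite /Delta minor_corner_add // /slide !inE; congr (_ + t * _).
case: ifP => // _; congr (minor Q _ _); apply/setP=> x; rewrite !inE !sum_eqE //=.
by rewrite negb_or.
Qed.

Lemma tnn_DeltaP Q : tnn Q <-> forall S, 0 <= Delta Q S.
Proof.
split=> [tQ S|h I J _]; rewrite /Delta.
  have [e|e] := eqVneq #|[set i | inl i \in S]| #|[set j | inr j \notin S]|; first exact: tQ.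
  by rewrite minor_card_neq.
have := h ((inl @: I) :|: (inr @: ~: J)); rewrite /Delta.
congr (0 <= minor Q _ _); apply/setP => x; rewrite !inE.
  by rewrite (mem_imset I _ (@inl_inj _ _)); case: imsetP => [[]|] //; rewrite orbF.
rewrite (mem_imset _ _ (@inr_inj _ _)) inE; case: imsetP => [[]|] //=.
by rewrite negbK.
Qed.

Lemma tnn_slide Q Q' a b t : 0 <= t -> (forall S, Delta Q' S = slide a b t (Delta Q) S) ->
  tnn Q -> tnn Q'.
Proof.
move=> t0 e /tnn_DeltaP tQ; apply/tnn_DeltaP => S; rewrite e /slide addr_ge0 // mulr_ge0 //.
by case: ifP.
Qed.

Lemma tnn_tr m m' (Q : 'M[R]_(m, m')) : tnn Q -> tnn Q^T.
Proof. by move=> tQ I J e; rewrite minor_tr tQ. Qed.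

Lemma tnn_increasing Q k (f : 'I_k -> 'I_n) (g : 'I_k -> 'I_n') :
  tnn Q -> increasing f -> increasing g -> 0 <= \det (mxsub f g Q).
Proof.
by move=> tQ incf incg; rewrite -minor_increasing //; apply: tQ; rewrite !card_increasing.
Qed.

Lemma increasing_tnn Q : (forall k (f : 'I_k -> 'I_n) (g : 'I_k -> 'I_n'),
  increasing f -> increasing g -> 0 <= \det (mxsub f g Q)) -> tnn Q.
Proof.
move=> h I J e; have [k [f [g [incf incg -> ->]]]] := increasing_param e.
by rewrite minor_increasing ?h.
Qed.

End Delta.

(** * Neville elimination for totally nonnegative matrices *)

Section Plucker.
Variables (R : comNzRingType) (m : nat) (M : 'M[R]_m) (p q : 'I_m).
Implicit Types x y a b c e : 'rV[R]_m.

Definition set_rows x y : 'M[R]_m :=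
  \matrix_(i, j) if i == p then x 0 j else if i == q then y 0 j else M i j.

Lemma cofactor_set_rows1 x x' y j : cofactor (set_rows x y) p j = cofactor (set_rows x' y) p j.
Proof.
rewrite /cofactor; congr (_ * \det _); apply/matrixP=> i k; rewrite !mxE.
by rewrite [lift p i == p]eq_sym (negbTE (neq_lift p i)).
Qed.

Lemma cofactor_set_rows2 x y y' j : p != q ->
  cofactor (set_rows x y) q j = cofactor (set_rows x y') q j.
Proof.
move=> pq; rewrite /cofactor; congr (_ * \det _); apply/matrixP=> i k; rewrite !mxE.
by rewrite [lift q i == q]eq_sym (negbTE (neq_lift q i)).
Qed.

Lemma det_set_rows1 x y : \det (set_rows x y) = \sum_j x 0 j * cofactor (set_rows 0 y) p j.
Proof.
rewrite (expand_det_row _ p); apply: eq_bigr => j _.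
by rewrite mxE eqxx (cofactor_set_rows1 _ 0).
Qed.

Lemma det_set_rows2 x y : p != q ->
  \det (set_rows x y) = \sum_j y 0 j * cofactor (set_rows x 0) q j.
Proof.
move=> pq; rewrite (expand_det_row _ q); apply: eq_bigr => j _.
by rewrite mxE [q == p]eq_sym (negbTE pq) eqxx (cofactor_set_rows2 _ _ 0).
Qed.

(* Cramer's rule expresses [\det N *: c] in the rows of [N := set_rows a b], and
   [\det (set_rows _ e)] is linear and kills all these rows but the two replaced ones. *)
Lemma det_set_rows_plucker a b c e : p != q ->
  \det (set_rows a b) * \det (set_rows c e) =
  \det (set_rows c b) * \det (set_rows a e) + \det (set_rows a c) * \det (set_rows b e).
Proof.
move=> pq; set N := set_rows a b; set v := \col_j cofactor (set_rows 0 e) p j.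
have L x : \det (set_rows x e) = (x *m v) 0 0.
  by rewrite det_set_rows1 mxE; apply: eq_bigr => j _; rewrite !mxE.
have coef l : (c *m \adj N) 0 l = \sum_j c 0 j * cofactor N l j.
  by rewrite mxE; apply: eq_bigr => j _; rewrite !mxE.
rewrite [in LHS]L -[LHS]/((\det N) * (c *m v) 0 0).
have -> : \det N * (c *m v) 0 0 = ((c *m \adj N) *m (N *m v)) 0 0.
  by rewrite mulmxA -(mulmxA c) mul_adj_mx mul_mx_scalar -scalemxAl [RHS]mxE.
rewrite mxE (bigD1 p) //= (bigD1 q) /= 1?eq_sym // big1 ?addr0.
  have Nv l : (N *m v) l 0 = (row l N *m v) 0 0 by rewrite -row_mul [RHS]mxE.
  have rp : row p N = a by apply/rowP=> j; rewrite !mxE eqxx.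
  have rq : row q N = b by apply/rowP=> j; rewrite !mxE [q == p]eq_sym (negbTE pq) eqxx.
  rewrite !coef !Nv rp rq -!L; congr (_ * _ + _ * _).
    by rewrite det_set_rows1; apply: eq_bigr => j _; rewrite (cofactor_set_rows1 _ 0).
  by rewrite det_set_rows2 //; apply: eq_bigr => j _; rewrite (cofactor_set_rows2 _ _ 0).
move=> l /andP[lp lq].
have -> : (N *m v) l 0 = (row l N *m v) 0 0 by rewrite -row_mul [RHS]mxE.
rewrite -L (determinant_alternate (i1 := p) (i2 := l)) ?mulr0 1?eq_sym // => j.
by rewrite !mxE eqxx (negbTE lp) (negbTE lq).
Qed.

End Plucker.

(** * Ratios of minors that differ in one row *)

Section Ratio.
Variables (R : realType) (n n' : nat) (Q : 'M[R]_(n, n')).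
Hypothesis tQ : tnn Q.
Variables (i h : 'I_n) (k : 'I_n').
Hypothesis ih : (i < h)%N.
Hypothesis col0 : forall c : 'I_n', (k < c)%N -> forall r, Q r c = 0.
Hypothesis above0 : forall r : 'I_n, (r < i)%N -> Q r k = 0.

Lemma tnn_ge0 (m m' : nat) (A : 'M[R]_(m, m')) r c : tnn A -> 0 <= A r c.
Proof.
move=> tA; have := @tnn_increasing _ _ _ A 1 (fun=> r) (fun=> c) tA.
rewrite det_mx11 mxE; apply; by move=> x y; rewrite !ord1.
Qed.

(** Here [i] is the last row of the minor. A column after [k] makes the left side zero. If column
    [k] occurs, only its bottom entry is nonzero, and the two sides agree. If all columns precede
    [k], the minor can be enlarged. *)
Lemma ratio_base m (f : 'I_m.+1 -> 'I_n) (g : 'I_m.+1 -> 'I_n') :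
  increasing f -> increasing g -> f ord_max = i ->
  Q i k * \det (mxsub (upd f ord_max h) g Q) <= Q h k * \det (mxsub f g Q).
Proof.
move=> incf incg fi.
have fx x : x != ord_max -> (f x < i)%N.
  by move=> xm; rewrite -fi; apply: incf; rewrite ltn_neqAle -ltnS ltn_ord andbT.
have [/existsP[x gx]|] := boolP [exists x, (k < g x)%N].
  rewrite (_ : \det (mxsub (upd _ _ _) _ _) = 0) ?mulr0.
    by rewrite mulr_ge0 ?tnn_ge0 // tnn_increasing.
  by rewrite -det_tr (@det_row0 _ _ _ x) // => j; rewrite !mxE col0.
rewrite negb_exists => /forallP gk.
have [/existsP[x /eqP gx]|] := boolP [exists x, g x == k].
  have detx (f' : 'I_m.+1 -> 'I_n) : (forall y, y != ord_max -> f' y = f y) ->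
      \det (mxsub f' g Q) = Q (f' ord_max) k * cofactor (mxsub f g Q) ord_max x.
    move=> ff'; rewrite (expand_det_col _ x) (bigD1 ord_max) //= big1 ?addr0 => [|a am].
      rewrite mxE gx; congr (_ * (_ * \det _)); apply/matrixP=> a b; rewrite !mxE ff' //.
      by rewrite eq_sym neq_lift.
    by rewrite mxE gx ff' // above0 ?mul0r ?fx.
  rewrite (detx f) // (detx (upd f ord_max h)); last by move=> y /negbTE; rewrite /upd => ->.
  by rewrite /upd eqxx fi mulrCA.
rewrite negb_exists => /forallP gk'.
have {gk gk'} gk x : (g x < k)%N.
  have := gk x; have : nat_of_ord (g x) <> k by move/val_inj/eqP; rewrite (negbTE (gk' x)).
  clear; lia.
(* Expand the minor with the additional row [h] and column [k] along this column, whose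
   only nonzero entries are in the rows [i] and [h]. *)
pose f' (x : 'I_m.+2) := if unlift ord_max x is Some y then f y else h.
pose g' (x : 'I_m.+2) := if unlift ord_max x is Some y then g y else k.
have f'l y : f' (lift ord_max y) = f y by rewrite /f' liftK.
have g'l y : g' (lift ord_max y) = g y by rewrite /g' liftK.
have f'm : f' ord_max = h by rewrite /f' unlift_none.
have g'm : g' ord_max = k by rewrite /g' unlift_none.
have fh y : (f y < h)%N.
  by have [->|/fx/ltn_trans->//] := eqVneq y ord_max; rewrite fi.
have lm (y : 'I_m.+1) : lift ord_max y = y :> nat by rewrite /= /bump leqNgt ltn_ord.
have incf' : increasing f'.
  move=> x y; case: (unliftP ord_max x) => [x' ->|->]; case: (unliftP ord_max y) => [y' ->|->].
  - by rewrite !lm !f'l; exact: incf.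
  - by rewrite f'l f'm.
  - by rewrite ltnNge -ltnS ltn_ord.
  - by rewrite ltnn.
have incg' : increasing g'.
  move=> x y; case: (unliftP ord_max x) => [x' ->|->]; case: (unliftP ord_max y) => [y' ->|->].
  - by rewrite !lm !g'l; exact: incg.
  - by rewrite g'l g'm.
  - by rewrite ltnNge -ltnS ltn_ord.
  - by rewrite ltnn.
have := tnn_increasing tQ incf' incg'.
rewrite (expand_det_col _ ord_max) (bigD1 ord_max) //=.
rewrite (bigD1 (lift ord_max (@ord_max m))) /=; last by rewrite eq_sym neq_lift.
rewrite big1 => [|x /andP[xm xl]]; last first.
  case: (unliftP ord_max x) xm xl => [y ->|->]; last by rewrite eqxx.
  rewrite (inj_eq lift_inj) => _ ym; rewrite mxE g'm f'l above0 ?mul0r //; exact: fx.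
rewrite addr0 !mxE g'm f'm f'l fi /cofactor.
rewrite -signr_odd oddD addbb mul1r lm -signr_odd addnS /= oddD addbb /= expr1.
rewrite mulN1r mulrN subr_ge0.
set d1 := \det _; set d2 := \det _ => le; apply: le_trans (le_trans le _).
  rewrite le_eqVlt; apply/orP; left; apply/eqP; congr (_ * \det _).
  apply/matrixP=> a b; rewrite !mxE g'l; congr (Q _ _).
  case: (unliftP ord_max a) => [a' ->|->].
    have -> : lift (lift ord_max (@ord_max m)) (lift ord_max a') = lift ord_max (lift ord_max a').
      by apply: val_inj; rewrite /= /bump; have := ltn_ord a'; lia.
    by rewrite f'l /upd eq_sym (negbTE (neq_lift _ _)).
  have -> : lift (lift ord_max (@ord_max m)) ord_max = ord_max.
    by apply: val_inj; rewrite /= /bump; lia.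
  by rewrite f'm /upd eqxx.
rewrite le_eqVlt; apply/orP; left; apply/eqP; congr (_ * \det _).
by apply/matrixP=> a b; rewrite !mxE g'l f'l.
Qed.

(** Replacing the next row [f q] with the unit vector at [j0] deletes row [q] and column [j0]; a
    three-term Pluecker relation then compares the claim with the smaller minors of the
    hypothesis. *)
Lemma ratio_step m (f : 'I_m.+1 -> 'I_n) (g : 'I_m.+1 -> 'I_n') (p q : 'I_m.+1) :
  increasing f -> increasing g -> f p = i -> q = p.+1 :> nat -> (h < f q)%N ->
  (forall j0 (p' : 'I_m), lift q p' = p ->
    Q i k * \det (mxsub (upd (f \o lift q) p' h) (g \o lift j0) Q) <=
    Q h k * \det (mxsub (f \o lift q) (g \o lift j0) Q)) ->
  Q i k * \det (mxsub (upd f p h) g Q) <= Q h k * \det (mxsub f g Q).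
Proof.
move=> incf incg fp qp hq IH.
have pq : p != q by apply/eqP => e; move: qp; rewrite e; clear; lia.
have injf := increasing_inj incf.
have incuf : increasing (upd f p h).
  apply: upd_increasing => // x xp; rewrite fp; split=> [xi|ix]; first exact: ltn_trans ih.
  have [->//|xq] := eqVneq x q; apply: ltn_trans hq _; apply: (incf).
  have : (p < x)%N.
    rewrite ltnNge leq_eqVlt negb_or xp /=; apply/negP => /incf; rewrite fp => h'.
    by have := ltn_trans ix h'; rewrite ltnn.
  have : nat_of_ord x <> q by move/val_inj/eqP; rewrite (negbTE xq).
  by rewrite qp; clear; lia.
have [/eqP D0|Dn0] := eqVneq (\det (mxsub (upd f p h) g Q)) 0.
  by rewrite (eqP D0) mulr0 mulr_ge0 ?tnn_ge0 ?tnn_increasing.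
have Dgt : 0 < \det (mxsub (upd f p h) g Q) by rewrite lt_def Dn0 tnn_increasing.
pose rho (a : 'I_n) : 'rV[R]_m.+1 := \row_j Q a (g j).
pose M := mxsub f g Q.
have FE a b : \det (set_rows M p q (rho a) (rho b)) = \det (mxsub (upd (upd f q b) p a) g Q).
  by congr (\det _); apply/matrixP=> x y; rewrite !mxE /upd; case: eqP => //; case: eqP.
(* With this choice of column the smaller minor [dh] is nonzero, so that it can be cancelled at the
   end. *)
have [j0 cof0] : exists j0, cofactor (mxsub (upd f p h) g Q) q j0 != 0.
  apply/existsP; apply: contraNT Dn0; rewrite negb_exists => /forallP c0.
  rewrite (expand_det_row _ q) big1 // => j _.
  by have := c0 j; rewrite negbK => /eqP->; rewrite mulr0.
have [p' pE] : exists p', lift q p' = p.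
  have qp' : q != p by rewrite eq_sym.
  by have [p' -> _] := unlift_some qp'; exists p'.
have Fe a : \det (set_rows M p q (rho a) (delta_mx 0 j0)) =
    (-1) ^+ (q + j0) * \det (mxsub (upd (f \o lift q) p' a) (g \o lift j0) Q).
  rewrite det_set_rows2 // (bigD1 j0) //= big1 ?addr0 => [|j jj0]; last first.
    by rewrite mxE eqxx (negbTE jj0) mul0r.
  rewrite mxE !eqxx mul1r /cofactor; congr (_ * \det _).
  apply/matrixP=> x y; rewrite !mxE -pE (inj_eq lift_inj) /upd.
  by rewrite [lift q x == q]eq_sym (negbTE (neq_lift _ _)); case: eqP => // _; rewrite !mxE.
(* In the Pluecker relation below, the term with the rows [i] and [h] is nonnegative and
   the others compare the two sides of the claim with those of [IH]. *)
pose r := f q.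
have plu := det_set_rows_plucker M (rho i) (rho r) (rho h) (delta_mx 0 j0) pq.
have updf : upd (upd f q r) p i =1 f.
  move=> x; rewrite /upd; have [->|_] := eqVneq x p; first by rewrite fp.
  by have [->|] := eqVneq x q.
have updh : upd (upd f q r) p h =1 upd f p h.
  move=> x; rewrite /upd; have [//|_] := eqVneq x p.
  by have [->|] := eqVneq x q.
have updi : upd (f \o lift q) p' i =1 f \o lift q.
  by move=> x; rewrite /upd; case: eqP => [->|//]; rewrite /= pE fp.
have mxsub_eq m' (f1 f2 : 'I_m' -> 'I_n) (g1 : 'I_m' -> 'I_n') : f1 =1 f2 ->
    mxsub f1 g1 Q = mxsub f2 g1 Q.
  by move=> e; apply/matrixP=> x y; rewrite !mxE e.
rewrite !Fe !FE (mxsub_eq _ _ _ _ updf) (mxsub_eq _ _ _ _ updh) (mxsub_eq _ _ _ _ updi) in plu.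
set D1 := \det (mxsub f g Q) in plu *; set D2 := \det (mxsub (upd f p h) g Q) in plu Dgt *.
set dh := \det (mxsub (upd (f \o lift q) p' h) _ _) in plu.
set di := \det (mxsub (f \o lift q) _ _) in plu.
have IH' : Q i k * dh <= Q h k * di by exact: IH.
have incl := increasing_lift q incf; have incgl := increasing_lift j0 incg.
have incsmall (a : 'I_n) : (i < a)%N -> (a <= r)%N -> increasing (upd (f \o lift q) p' a).
  move=> ia ar; apply: upd_increasing => // x xp'; rewrite /= pE fp; split=> [xi|ix].
    exact: ltn_trans ia.
  apply: leq_ltn_trans ar _; apply: (incf).
  have : (p < lift q x)%N.
    rewrite ltnNge leq_eqVlt negb_or; apply/andP; split.
      by rewrite -{1}pE val_eqE (inj_eq lift_inj).
    apply/negP => /incf; rewrite fp => h'.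
    by have := ltn_trans ix h'; rewrite ltnn.
  have : nat_of_ord q <> lift q x by move/val_inj/eqP; rewrite (negbTE (neq_lift _ _)).
  by rewrite qp; clear; lia.
have dh_ge0 : 0 <= dh by apply: tnn_increasing => //; exact: incsmall (ltnW hq).
have dr_ge0 : 0 <= \det (mxsub (upd (f \o lift q) p' r) (g \o lift j0) Q).
  by apply: tnn_increasing => //; apply: incsmall => //; exact: ltn_trans hq.
have Dih : 0 <= \det (mxsub (upd (upd f q h) p i) g Q).
  have updhi : upd (upd f q h) p i =1 upd f q h.
    by move=> x; rewrite /upd; have [->|//] := eqVneq x p; rewrite (negbTE pq) fp.
  rewrite (mxsub_eq _ _ _ _ updhi); apply: tnn_increasing => //.
  apply: upd_increasing => // x xq; split=> [xr|rx]; last exact: ltn_trans rx.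
  apply: leq_ltn_trans ih; rewrite -fp leqNgt; apply/negP => px.
  have : (p < x)%N.
    rewrite ltnNge leq_eqVlt negb_or; apply/andP; split.
      by apply/negP => /eqP/val_inj e; rewrite e ltnn in px.
    by apply/negP => /incf h'; have := ltn_trans px h'; rewrite ltnn.
  have : (x < q)%N.
    rewrite ltnNge leq_eqVlt negb_or; apply/andP; split.
      by apply/negP => /eqP/val_inj e; rewrite e ltnn in xr.
    by apply/negP => /incf h'; have := ltn_trans xr h'; rewrite ltnn.
  by rewrite qp; clear; lia.
set dr := \det (mxsub (upd (f \o lift q) p' r) _ _) in plu dr_ge0.
set Dih' := \det (mxsub (upd (upd f q h) p i) g Q) in plu Dih.
have {}plu : D1 * dh = D2 * di + Dih' * dr.
  have s0 : ((-1) ^+ (q + j0) : R) != 0 by rewrite signr_eq0.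
  by apply: (mulfI s0); rewrite mulrDr; move: plu; rewrite ![_ * ((-1) ^+ _ * _)]mulrCA.
have dh_gt : 0 < dh.
  rewrite lt_def dh_ge0 andbT; apply: contra_neq cof0 => dh0.
  rewrite /cofactor (_ : row' q (col' j0 _) = mxsub (upd (f \o lift q) p' h) (g \o lift j0) Q).
    by rewrite -/dh dh0 mulr0.
  by apply/matrixP=> x y; rewrite !mxE /upd -pE (inj_eq lift_inj).
(* After multiplication by [dh], the hypothesis gives the bound [Q h k * (D2 * di)], and the
   Pluecker relation gives [D2 * di <= D1 * dh]. *)
rewrite -(ler_pM2r dh_gt) -!mulrA plu.
apply: le_trans (_ : Q h k * (D2 * di) <= _).
  rewrite mulrCA [leRHS]mulrCA; apply: ler_wpM2l => //; exact: ltW.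
by apply: ler_wpM2l; [exact: tnn_ge0|rewrite lerDl mulr_ge0].
Qed.

(** Induction on the number of rows after [p]. The difference of the two sides, divided by [Q h k],
    is the minor obtained when row [i] is cleared in column [k] with the help of row [h]. *)
Lemma ratio m (f : 'I_m -> 'I_n) (g : 'I_m -> 'I_n') (p : 'I_m) :
  increasing f -> increasing g -> f p = i ->
  (forall x : 'I_m, (p < x)%N -> (h < f x)%N) ->
  Q i k * \det (mxsub (upd f p h) g Q) <= Q h k * \det (mxsub f g Q).
Proof.
case: m f g p => [f g [//]|m] f g p incf incg fp hx.
move: {2}(m - p)%N (erefl (m - p)%N) => d.
elim: d m f g p incf incg fp hx => [|d IH] m f g p incf incg fp hx e.
  have pm : p = ord_max by apply: val_inj; have := ltn_ord p; rewrite /=; move: e; clear; lia.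
  by rewrite pm in fp *; exact: ratio_base.
have qm : (p.+1 < m.+1)%N by move: e; clear; lia.
apply: (@ratio_step _ _ _ p (Ordinal qm)) => //; first by apply: hx => /=.
move=> j0 p' pE; case: m f g p incf incg fp hx e qm j0 p' pE => [|m] f g p
  incf incg fp hx e qm j0 p' pE.
  by case: p' {pE}.
have p'E : p' = p :> nat by have := congr1 val pE; rewrite /= /bump; clear; lia.
apply: IH.
- exact: increasing_lift.
- exact: increasing_lift.
- by rewrite /= pE.
- by move=> x px; apply: hx; rewrite /= /bump; move: px p'E; clear; lia.
- by rewrite p'E; move: e; clear; lia.
Qed.

(** The elimination step. A minor changes only if it uses [i] but neither [h] nor a zero row between
    them; its later rows are then all below [h], as [ratio] requires. *)
Lemma tnn_row_sub : 0 < Q h k ->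
  (forall r : 'I_n, (i < r < h)%N -> forall j, Q r j = 0) ->
  tnn (row_add i h (- (Q i k / Q h k)) Q).
Proof.
move=> Qhk btw; apply: increasing_tnn => m f g incf incg; have injf := increasing_inj incf.
have [/imsetP[p _ ip]|iI] := boolP (i \in f @: 'I_m); last first.
  rewrite (_ : mxsub _ _ _ = mxsub f g Q); first exact: tnn_increasing.
  apply/matrixP=> x y; rewrite !mxE; case: eqP => [e|]; rewrite ?addr0 //.
  by rewrite -e imset_f in iI.
have := det_row_add g Q p h (- (Q i k / Q h k)) injf.
rewrite -ip => ->; rewrite mulNr subr_ge0.
have [/imsetP[q _ hq]|hI] := boolP (h \in f @: 'I_m).
  have qp : q != p by apply/eqP => e; move: ih; rewrite ip hq e ltnn.
  rewrite (determinant_alternate (i1 := p) (i2 := q)) 1?eq_sym ?mulr0 ?tnn_increasing // => j.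
  by rewrite !mxE /upd eqxx (negbTE qp) hq.
have [/existsP[x hx]|] := boolP [exists x, (i < f x < h)%N].
  have xp : x != p by apply/eqP => xp; move: hx; rewrite xp -ip; clear; lia.
  rewrite (@det_row0 _ _ _ x) ?mulr0 ?tnn_increasing // => j.
  by rewrite !mxE /upd (negbTE xp) btw.
rewrite negb_exists => /forallP nx; rewrite mulrAC ler_pdivrMr // [leRHS]mulrC.
apply: ratio => // x px; have := incf _ _ px; rewrite -ip => ix; have := nx x; rewrite ix -leqNgt.
by rewrite leq_eqVlt => /orP[/eqP/val_inj e|//]; rewrite e imset_f in hI.
Qed.

End Ratio.

Lemma det_mx22 (R : comNzRingType) (A : 'M[R]_2) : \det A = A 0 0 * A 1 1 - A 0 1 * A 1 0.
Proof.
rewrite (expand_det_row _ 0) !big_ord_recl big_ord0 /cofactor !det_mx11 !mxE /= expr0 expr1.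
rewrite (_ : lift 0 0 = 1); last exact: val_inj.
rewrite (_ : lift 1 0 = 0); last exact: val_inj.
by rewrite mul1r mulN1r mulrN addr0.
Qed.

Definition nonzeros (R : realType) (n n' : nat) (Q : 'M[R]_(n, n')) : {set 'I_n * 'I_n'} :=
  [set u | Q u.1 u.2 != 0].

(** For [j < k] the minor with rows [i], [r] and columns [j], [k] equals [- (Q i k * Q r j)], which
    forces [Q r j = 0]. *)
Lemma tnn_row_vanish (R : realType) (n n' : nat) (Q : 'M[R]_(n, n')) (i r : 'I_n) (k : 'I_n') :
  tnn Q -> (forall c : 'I_n', (k < c)%N -> forall s, Q s c = 0) ->
  (i < r)%N -> Q i k != 0 -> Q r k = 0 -> forall j, Q r j = 0.
Proof.
move=> tQ col0 ir Qik Qrk j; have [jk|kj|/val_inj->//] := ltngtP j k; last exact: col0.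
have Qik0 : 0 < Q i k by rewrite lt_def Qik tnn_ge0.
apply/eqP; rewrite eq_le tnn_ge0 // andbT.
pose f (x : 'I_2) := if x == 0 then i else r; pose g (x : 'I_2) := if x == 0 then j else k.
have ord2 (x : 'I_2) : x = 0 \/ x = 1 by case: x => [[|[|]]] // ?; [left|right]; exact: val_inj.
have incf : increasing f by move=> x y; case: (ord2 x) => ->; case: (ord2 y) => ->.
have incg : increasing g by move=> x y; case: (ord2 x) => ->; case: (ord2 y) => ->.
have := tnn_increasing tQ incf incg; rewrite det_mx22 !mxE /f /g /= Qrk mulr0 sub0r oppr_ge0.
by rewrite pmulr_rle0.
Qed.

(** [i] and [h] are the first two rows with a nonzero entry in the last nonzero column [k]; the rows
    between them vanish by [tnn_row_vanish]. The entry at [i], [k] is cleared, and no zero entry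
    becomes nonzero, as it could only become negative. *)
Lemma row_reduction (R : realType) (n n' : nat) (Q : 'M[R]_(n, n')) (k : 'I_n') (a b : 'I_n) :
  tnn Q -> (forall c : 'I_n', (k < c)%N -> forall s, Q s c = 0) ->
  a != b -> Q a k != 0 -> Q b k != 0 ->
  exists (i h : 'I_n) (t : R) (B : 'M[R]_(n, n')),
    [/\ (i < h)%N, 0 <= t, tnn B, (#|nonzeros B| < #|nonzeros Q|)%N &
    Q = row_add i h t B /\ forall r : 'I_n, (i < r < h)%N -> forall j, B r j = 0].
Proof.
move=> tQ col0 ab Qa Qb.
have [i Qi mini] := arg_minnP (P := fun r => Q r k != 0) (fun r : 'I_n => nat_of_ord r) Qa.
have [c Qc ci] : exists2 c, Q c k != 0 & c != i.
  by have [e|ai] := eqVneq a i; [exists b; rewrite // -e eq_sym|exists a].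
have [h /andP[Qh hi] minh] := arg_minnP (P := fun r => (Q r k != 0) && (r != i))
  (fun r : 'I_n => nat_of_ord r) (introT andP (conj Qc ci)).
have ih : (i < h)%N.
  by rewrite ltn_neqAle mini // andbT; apply: contra_neq hi => /val_inj.
have btwk (r : 'I_n) : (i < r < h)%N -> Q r k = 0.
  move=> /andP[ir rh]; apply/eqP; apply: contraLR rh => Qr; rewrite -leqNgt; apply: minh.
  by rewrite Qr; apply: contraTneq ir => ->; rewrite ltnn.
have btw (r : 'I_n) : (i < r < h)%N -> forall j, Q r j = 0.
  by move=> hr; have /andP[ir _] := hr; apply: (tnn_row_vanish tQ col0 ir Qi); exact: btwk.
have above0 (r : 'I_n) : (r < i)%N -> Q r k = 0.
  by move=> ri; apply/eqP; apply: contraLR ri => Qr; rewrite -leqNgt; exact: mini.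
have Qhk : 0 < Q h k by rewrite lt_def Qh tnn_ge0.
pose t := Q i k / Q h k; pose B := row_add i h (- t) Q.
have t0 : 0 <= t by rewrite divr_ge0 ?tnn_ge0.
have tB : tnn B by exact: tnn_row_sub.
have hi' : h == i = false by exact: negbTE.
exists i, h, t, B; split=> //; last first.
  split; last first.
    move=> r hr j; rewrite mxE btw // add0r; case: eqP => // e.
    by move: hr; rewrite e ltnn.
  apply/matrixP=> x y; rewrite !mxE hi' addr0; case: eqP => _; last by rewrite !addr0.
  by rewrite mulNr subrK.
apply: proper_card; apply/properP; split.
  apply/subsetP => -[x y]; rewrite !inE /=; apply: contra_neq => Qxy.
  apply/eqP; rewrite eq_le tnn_ge0 // andbT mxE Qxy add0r.
  by case: ifP => // _; rewrite mulNr oppr_le0 mulr_ge0 // tnn_ge0.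
exists (i, k); rewrite !inE //= negbK !mxE eqxx mulNr divfK ?subrr //.
Qed.

(** * Positivity for totally nonnegative matrices *)

Lemma circle_pos_inj n n' : injective (@circle_pos n n').
Proof.
move=> [i|j] [i'|j'] /=.
- by move/val_inj => ->.
- by have := ltn_ord i; clear; lia.
- by have := ltn_ord i'; clear; lia.
- have := ltn_ord j; have := ltn_ord j' => h h' e; congr inr; apply: val_inj => /=.
  by move: h h' e; clear; lia.
Qed.

Lemma matching_positive_ext (R : realFieldType) (T : finType) (pos : T -> nat)
    (D D' : {set T} -> R) :
  D =1 D' -> matching_positive pos D -> matching_positive pos D'.
Proof.
move=> e pD X Y d XY hd; have := pD X Y d XY hd; congr (0 <= _).
by apply: eq_bigr => C _; rewrite !e.
Qed.

Section Positive.
Variables (R : realType) (n n' : nat).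
Implicit Types Q : 'M[R]_(n, n').

Lemma negligible_row Q (r : 'I_n) : (forall j, Q r j = 0) -> negligible (Delta Q) (inl r).
Proof. by move=> Qr; left => S rS; apply: (@minor_row0 _ _ _ _ _ _ r); rewrite ?inE. Qed.

Lemma negligible_col Q (c : 'I_n') : (forall i, Q i c = 0) -> negligible (Delta Q) (inr c).
Proof. by move=> Qc; right => S cS; apply: (@minor_col0 _ _ _ _ _ _ c); rewrite ?inE. Qed.

(** If [Y] is nonempty, it contains a negligible point and the sum is zero. If [Y] is empty, the sum
    is [d set0], the only matching sum, times a square. *)
Lemma matching_positive0 Q : nonzeros Q = set0 -> matching_positive (@circle_pos n n') (Delta Q).
Proof.
move=> nz; have Q0 i j : Q i j = 0.
  by apply/eqP; apply: contraFT (in_set0 (i, j)); rewrite -nz inE.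
move=> X Y d XY hd; have [Y0|/set0Pn[z zY]] := eqVneq Y set0.
  rewrite Y0 product_sum0 mulr_ge0 ?sqr_ge0 //.
  have := hd id; rewrite Y0 matching_sum0; apply.
  by split=> y; rewrite ?inE // => x; rewrite inE.
rewrite (negligible_product d XY _ zY) //; case: z {zY} => z.
  exact: negligible_row.
exact: negligible_col.
Qed.

Lemma nonzeros_tr (m m' : nat) (A : 'M[R]_(m, m')) : #|nonzeros A^T| = #|nonzeros A|.
Proof.
have inj : injective (fun u : 'I_m * 'I_m' => (u.2, u.1)) by move=> [a b] [c d] [-> ->].
rewrite -(card_imset _ inj); apply: eq_card => -[a b]; rewrite inE mxE.
apply/idP/imsetP => [Aba|[[c d]]]; last by rewrite inE => Acd [-> ->].
by exists (b, a); rewrite ?inE.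
Qed.

(** Induction on the number of nonzero entries. A second nonzero entry in the last nonzero column
    [k] allows a row reduction. Otherwise the row [i] of the only one is the last nonzero row, and a
    second nonzero entry there allows a column reduction by transposition. Otherwise the entry is
    removed by a corner operation. *)
Lemma tnn_matching_positive Q : tnn Q -> matching_positive (@circle_pos n n') (Delta Q).
Proof.
move: {2}#|nonzeros Q| (leqnn #|nonzeros Q|) => N.
elim: N Q => [|N IH] Q hN tQ.
  by apply: matching_positive0; apply/eqP; rewrite -cards_eq0 -leqn0.
have [/matching_positive0//|/set0Pn[[i0 k0]]] := eqVneq (nonzeros Q) set0.
rewrite inE /= => Q00.
have ex0 : [exists i, Q i k0 != 0] by apply/existsP; exists i0.
have [k /existsP[i Qik] maxk] := arg_maxnP (P := fun c => [exists i, Q i c != 0])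
  (fun c : 'I_n' => nat_of_ord c) ex0.
have col0 (c : 'I_n') : (k < c)%N -> forall s, Q s c = 0.
  move=> kc s; apply/eqP; apply: contraLR kc => Qsc; rewrite -leqNgt; apply: maxk.
  by apply/existsP; exists s.
have [/existsP[b /andP[bi Qbk]]|] := boolP [exists b, (b != i) && (Q b k != 0)].
  have [x [h [t [B [xh t0 tB nzB [QE btw]]]]]] := row_reduction tQ col0 bi Qbk Qik.
  have xh' : x != h by apply/eqP => e; move: xh; rewrite e ltnn.
  apply: (@matching_positive_ext _ _ _ (slide (inl x) (inl h) t (Delta B))).
    move=> S; rewrite QE Delta_row_add // => r /orP[|/andP[hr rx]]; first exact: btw.
    by have := ltn_trans (ltn_trans hr rx) xh; rewrite ltnn.
  apply: (matching_positive_slide (@circle_pos_inj n n')) => //; last first.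
    by apply: IH => //; rewrite -ltnS; exact: leq_trans nzB hN.
  move=> [r|c] /=; last by have := ltn_ord h; have := ltn_ord x; clear; lia.
  move=> hr; apply: negligible_row; apply: btw; move: hr xh; clear; lia.
rewrite negb_exists => /forallP only.
have colk r : r != i -> Q r k = 0.
  by move=> ri; have := only r; rewrite ri /= negbK => /eqP.
have row0 (r : 'I_n) : (i < r)%N -> forall j, Q r j = 0.
  move=> ir; apply: (tnn_row_vanish tQ col0 ir Qik); apply: colk.
  by apply: contraTneq ir => ->; rewrite ltnn.
have [/existsP[b /andP[bk Qib]]|] := boolP [exists b, (b != k) && (Q i b != 0)].
  have row0' (c : 'I_n) : (i < c)%N -> forall s, Q^T s c = 0.
    by move=> ic s; rewrite mxE row0.
  have Qb' : Q^T b i != 0 by rewrite mxE.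
  have Qk' : Q^T k i != 0 by rewrite mxE.
  have [x [h [t [B [xh t0 tB nzB [QE btw]]]]]] := row_reduction (tnn_tr tQ) row0' bk Qb' Qk'.
  have xh' : x != h by apply/eqP => e; move: xh; rewrite e ltnn.
  apply: (@matching_positive_ext _ _ _ (slide (inr h) (inr x) t (Delta B^T))).
    move=> S; rewrite -[Q]trmxK QE -Delta_col_add //; first by rewrite /col_add trmxK.
    move=> c /orP[hc|/andP[hr rx]] s; first by rewrite mxE btw.
    by have := ltn_trans (ltn_trans hr rx) xh; rewrite ltnn.
  apply: (matching_positive_slide (@circle_pos_inj n n')) => //; last first.
  - apply: IH; last exact: tnn_tr.
    by rewrite nonzeros_tr -ltnS; apply: leq_trans nzB _; rewrite nonzeros_tr.
  - move=> [r|c] /=; first by have := ltn_ord r; clear; lia.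
    move=> hc; apply: negligible_col => s; rewrite mxE btw //.
    by have := ltn_ord c; have := ltn_ord h; move: hc xh; clear; lia.
  - by rewrite eq_sym.
rewrite negb_exists => /forallP only'.
have rowi b : b != k -> Q i b = 0.
  by move=> bk; have := only' b; rewrite bk /= negbK => /eqP.
(* The entry at [i], [k] is alone in its row and column. Minors of [B] that use row [i] vanish, and
   all others are minors of [Q]. *)
pose B := corner_add i k (- Q i k) Q.
have Bi j : B i j = 0.
  by rewrite mxE eqxx /=; have [->|/rowi->] := eqVneq j k; rewrite ?subrr ?addr0.
have Bne r j : r != i -> B r j = Q r j by move=> /negbTE ri; rewrite mxE ri addr0.
have tB : tnn B.
  apply: increasing_tnn => m f g incf incg.
  have [/imsetP[p _ ip]|iI] := boolP (i \in f @: 'I_m).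
    by rewrite (@det_row0 _ _ _ p) // => j; rewrite mxE -ip Bi.
  rewrite (_ : mxsub f g B = mxsub f g Q); first exact: tnn_increasing.
  apply/matrixP=> x y; rewrite !mxE [f x == i](_ : _ = false) ?addr0 //.
  by apply: contraNF iI => /eqP <-; rewrite imset_f.
have nzB : (#|nonzeros B| < #|nonzeros Q|)%N.
  apply: proper_card; apply/properP; split; last by exists (i, k); rewrite !inE //= Bi eqxx.
  apply/subsetP => -[x y]; rewrite !inE /=; have [->|xi] := eqVneq x i; first by rewrite Bi eqxx.
  by rewrite Bne.
apply: (@matching_positive_ext _ _ _ (slide (inl i) (inr k) (Q i k) (Delta B))).
  move=> S; rewrite -Delta_corner_add.
  - congr (Delta _ S); apply/matrixP=> x y; rewrite !mxE -addrA.
    by case: ifP => _; rewrite ?addNr ?addr0.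
  - move=> r ir j; rewrite Bne ?row0 //; by apply: contraTneq ir => ->; rewrite ltnn.
  - move=> c kc r; have [->|ri] := eqVneq r i; first by rewrite Bi.
    by rewrite Bne // col0.
apply: (matching_positive_slide (@circle_pos_inj n n')) => //; last first.
- by apply: IH => //; rewrite -ltnS; exact: leq_trans nzB hN.
- move=> [r|c] /= hz; [apply: negligible_row => j|apply: negligible_col => r].
    have ir : (i < r)%N by move: hz; have := ltn_ord r; clear; lia.
    by rewrite Bne ?row0 //; apply: contraTneq ir => ->; rewrite ltnn.
  have kc : (k < c)%N.
    by move: hz; have := ltn_ord c; have := ltn_ord k; have := ltn_ord i; clear; lia.
  by have [->|ri] := eqVneq r i; rewrite ?Bi // Bne // col0.
- exact: tnn_ge0.
Qed.

End Positive.

(** * Realizing a single matching *)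

Section Closure.
Variables (R : realType) (n n' : nat).

(** Stated up to pointwise equality, because a slide of [Delta Q] is only pointwise equal to some
    [Delta Q']. *)
Definition tnn_Delta (D : {set point n n'} -> R) : Prop :=
  exists2 Q : 'M[R]_(n, n'), tnn Q & D =1 Delta Q.

Lemma tnn_Delta_slide (a b : point n n') :
  (forall (Q : 'M[R]_(n, n')) t, exists Q', Delta Q' =1 slide a b t (Delta Q)) ->
  slide_closed tnn_Delta a b.
Proof.
move=> ex D t [Q tQ DQ] t0; have [Q' eQ'] := ex Q t.
exists Q'; first by apply: (tnn_slide t0 eQ' tQ).
by move=> S; rewrite eQ' /slide !DQ.
Qed.

(** Row operations serve the lower half and column operations the upper half. At the junction [i] is
    the last row and [j] the last column, so the conditions of the corner operation hold
    vacuously. *)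
Lemma tnn_Delta_up (a b : point n n') : circle_pos b = (circle_pos a).+1 ->
  slide_closed tnn_Delta a b.
Proof.
case: a b => [i|h] [h'|j] /= e; apply: tnn_Delta_slide => Q t.
- exists (row_add i h' t Q) => S; apply: Delta_row_add; first by apply/eqP => ih;
    move: e; rewrite ih; clear; lia.
  by move=> r; move: e; clear; lia.
- exists (corner_add i j t Q) => S; apply: Delta_corner_add => r.
    by have := ltn_ord r; move: e; have := ltn_ord j; clear; lia.
  by have := ltn_ord r; move: e; have := ltn_ord i; clear; lia.
- by have := ltn_ord h'; move: e; clear; lia.
- have := ltn_ord j; have := ltn_ord h => hn jn.
  exists (col_add j h t Q) => S; apply: Delta_col_add; first by apply/eqP => ih;
    move: e; rewrite ih; clear; lia.
  by move=> c; move: e hn jn; clear; lia.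
Qed.

Lemma tnn_Delta_down (a b : point n n') : circle_pos a = (circle_pos b).+1 ->
  circle_pos a <> n -> slide_closed tnn_Delta a b.
Proof.
case: a b => [i|h] [h'|j] /= e ne; apply: tnn_Delta_slide => Q t.
- exists (row_add i h' t Q) => S; apply: Delta_row_add; first by apply/eqP => ih;
    move: e; rewrite ih; clear; lia.
  by move=> r; move: e; clear; lia.
- by have := ltn_ord i; move: e; clear; lia.
- by have := ltn_ord h'; move: e ne; clear; lia.
- have := ltn_ord j; have := ltn_ord h => hn jn.
  exists (col_add j h t Q) => S; apply: Delta_col_add; first by apply/eqP => ih;
    move: e; rewrite ih; clear; lia.
  by move=> c; move: e hn jn; clear; lia.
Qed.

Lemma circle_pos_lt (a : point n n') : (circle_pos a < n + n')%N.
Proof. by case: a => [i|j] /=; [have := ltn_ord i|have := ltn_ord j]; clear; lia. Qed.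

Lemma circle_pos_surj v : (v < n + n')%N -> exists a : point n n', circle_pos a = v.
Proof.
move=> vn; have [vl|vl] := ltnP v n; first by exists (inl (Ordinal vl)).
have h : (n' - (v - n).+1 < n')%N by lia.
by exists (inr (Ordinal h)) => /=; lia.
Qed.

Lemma minor_set0 (Q : 'M[R]_(n, n')) : minor Q set0 set0 = 1.
Proof.
pose f (x : 'I_0) : 'I_n := match x with Ordinal _ h => False_rect _ (notF h) end.
pose g (x : 'I_0) : 'I_n' := match x with Ordinal _ h => False_rect _ (notF h) end.
rewrite (_ : set0 = f @: 'I_0); last by apply/setP=> x; rewrite inE; apply/esym/imsetP => -[[]].
rewrite (_ : set0 = g @: 'I_0); last by apply/setP=> x; rewrite inE; apply/esym/imsetP => -[[]].
by rewrite minor_increasing ?det_mx00 // => -[].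
Qed.

Lemma tnn0 : tnn (0 : 'M[R]_(n, n')).
Proof.
apply: increasing_tnn => -[|m] f g incf incg; first by rewrite det_mx00.
by rewrite (@det_row0 _ _ _ ord0) // => j; rewrite !mxE.
Qed.

Lemma card_glue (A : {set 'I_n}) (B : {set 'I_n'}) :
  #|((inl @: A) :|: (inr @: B) : {set point n n'})| = (#|A| + #|B|)%N.
Proof.
rewrite cardsU (card_imset _ (@inl_inj _ _)) (card_imset _ (@inr_inj _ _)).
rewrite (_ : _ :&: _ = set0) ?cards0 ?subn0 //; apply/setP=> u; rewrite !inE.
by apply/negP => /andP[/imsetP[x _ ->] /imsetP[]].
Qed.

Lemma mem_glue_l (A : {set 'I_n}) (B : {set 'I_n'}) i :
  (inl i \in ((inl @: A) :|: (inr @: B) : {set point n n'})) = (i \in A).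
Proof.
by rewrite inE (mem_imset _ _ (@inl_inj _ _)); case: imsetP => [[]|] //; rewrite orbF.
Qed.

Lemma mem_glue_r (A : {set 'I_n}) (B : {set 'I_n'}) j :
  (inr j \in ((inl @: A) :|: (inr @: B) : {set point n n'})) = (j \in B).
Proof.
by rewrite inE (mem_imset B _ (@inr_inj _ _)); case: imsetP => [[]|].
Qed.

Lemma upper_half : [set z : point n n' | (n <= circle_pos z)%N] = (inl @: set0) :|: (inr @: setT).
Proof.
apply/setP=> -[i|j]; rewrite ?mem_glue_l ?mem_glue_r !inE /=; last by rewrite leq_addr.
by apply/negbTE; rewrite -ltnNge.
Qed.

Lemma tnn_product_positive_matching (X Y : {set point n n'}) f d :
  [disjoint X & Y] -> noncrossing (@circle_pos n n') Y f ->
  (#|X|.*2 + #|Y| = n'.*2)%N ->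
  (forall Q : 'M[R]_(n, n'), tnn Q -> 0 <= product_sum X Y (Delta Q) d) ->
  0 <= matching_sum Y f d :> R.
Proof.
move=> XY nc bal pos; have [pred succ] : 
    (forall a b : point n n', (circle_pos a < circle_pos b)%N ->
       exists c : point n n', circle_pos b = (circle_pos c).+1) /\
    (forall a b : point n n', (circle_pos a < circle_pos b)%N ->
       exists c : point n n', circle_pos c = (circle_pos a).+1).
  split=> a b ab.
    have [|c e] := @circle_pos_surj (circle_pos b).-1.
      exact: leq_ltn_trans (leq_pred _) (circle_pos_lt b).
    by exists c; rewrite e prednK // (leq_ltn_trans _ ab).
  exact: circle_pos_surj (leq_ltn_trans ab (circle_pos_lt b)).
apply: (product_positive_matching (@circle_pos_inj n n') tnn_Delta_up tnn_Delta_down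
  succ pred (D0 := Delta 0) _ _ XY nc) => //.
- by exists 0 => //; exact: tnn0.
- rewrite upper_half /Delta (_ : [set i | _] = set0); last first.
    by apply/setP=> i; rewrite inE mem_glue_l !inE.
  rewrite (_ : [set j | _] = set0) ?minor_set0 ?oner_eq0 //.
  by apply/setP=> j; rewrite inE mem_glue_r !inE.
- by rewrite upper_half card_glue cards0 cardsT card_ord.
- move=> D [Q tQ DQ]; have := pos Q tQ; congr (0 <= _).
  by apply: eq_bigr => C _; rewrite !DQ.
Qed.

End Closure.

(** * Couples, colours and families *)

Section Couples.
Variables (n n' : nat) (Y : {set 'I_n}) (Y' : {set 'I_n'}).
Local Notation T := (point n n').
Local Notation Yt := (points Y Y').
Implicit Types (f : T -> T) (p : {set 'I_n} * {set 'I_n'}).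

Definition couples f : {set {set T}} := [set [set y; f y] | y in Yt].

(* Whiteness with the colours of the upper half flipped. *)
Definition encode p : {set T} := (inl @: p.1) :|: (inr @: (Y' :\: p.2)).

Lemma couplesP f c u v : noncrossing (@circle_pos n n') Yt f ->
  c \in couples f -> u \in c -> v \in c -> u != v -> u \in Yt /\ v = f u.
Proof.
case=> fY _ ff _ /imsetP[y yY ->]; rewrite !in_set2 => /orP[/eqP->|/eqP->] /orP[/eqP->|/eqP->];
  rewrite ?eqxx //= => _.
by rewrite fY // ff.
Qed.

Lemma perfect_matching_couples f : noncrossing (@circle_pos n n') Yt f ->
  perfect_matching Y Y' (couples f).
Proof.
move=> nc; have [fY fne ff _] := nc; apply/andP; split; last first.
  by apply/forall_inP => _ /imsetP[y yY ->]; rewrite cards2 [y == _]eq_sym fne.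
apply/and3P; split.
- apply/eqP/setP=> u; apply/bigcupP/idP => [[_ /imsetP[y yY ->]]|uY].
    by rewrite in_set2 => /orP[] /eqP->; rewrite ?fY.
  by exists [set u; f u]; [exact: imset_f|rewrite in_set2 eqxx].
- have couple_of x u : x \in Yt -> u \in [set x; f x] -> [set x; f x] = [set u; f u].
    by move=> xY; rewrite in_set2 => /orP[] /eqP-> //; rewrite ff // setUC.
  apply/trivIsetP => _ _ /imsetP[x xY ->] /imsetP[y yY ->] neq.
  apply/pred0P => u /=; apply: contraNF neq => /andP[ux uy].
  by rewrite (couple_of x u) // (couple_of y u).
- by apply/imsetP => -[y _ /setP/(_ y)]; rewrite !inE eqxx.
Qed.

Lemma planar_couples f : noncrossing (@circle_pos n n') Yt f -> planar (couples f).
Proof.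
move=> nc; have [_ _ _ fnc] := nc.
apply/forall_inP => c1 c1M; apply/forall_inP => c2 c2M.
apply/forall_inP => a ac; apply/forall_inP => b bc.
apply/forall_inP => c cc; apply/forall_inP => d dc.
apply/negP => /and3P[ac' cb bd].
have ab : a != b by apply/eqP => e; have := ltn_trans ac' cb; rewrite e ltnn.
have cd : c != d by apply/eqP => e; have := ltn_trans cb bd; rewrite e ltnn.
have [aY be] := couplesP nc c1M ac bc ab; have [cY de] := couplesP nc c2M cc dc cd.
by have := fnc a c aY cY; rewrite -be -de ac' cb bd.
Qed.

Lemma mem_encode p u : u \in Yt -> (u \in encode p) = (white p u == lower u).
Proof.
case: u => [i|j]; rewrite /encode ?mem_glue_l ?mem_glue_r /=; first by rewrite eqb_id.
by rewrite inE => ->; rewrite andbT eqbF_neg.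
Qed.

Lemma color_compatible_couples f p : noncrossing (@circle_pos n n') Yt f ->
  color_compatible p (couples f) = bichromatic Yt f (encode p).
Proof.
move=> nc; have [fY fne ff _] := nc.
(* The flip of the upper colours merges the two colour conditions: same half with different colours,
   and different halves with equal colours, both become bichromatic. *)
have E u : u \in Yt -> ((f u \in encode p) != (u \in encode p)) =
    ((white p u != white p (f u)) ==> (lower u == lower (f u))) &&
    ((white p u == white p (f u)) ==> (lower u != lower (f u))).
  move=> uY; rewrite !mem_encode ?fY //.
  by case: (white p u); case: (white p (f u)); case: (lower u); case: (lower (f u)).
apply/forall_inP/forall_inP => [h y yY|h c cM].
  rewrite E //; have cM : [set y; f y] \in couples f by exact: imset_f.
  have /forall_inP/(_ y) := h _ cM; rewrite !inE eqxx => /(_ isT) /forall_inP/(_ (f y)).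
  by rewrite !inE eqxx orbT => /(_ isT); rewrite eq_sym fne.
apply/forall_inP => u uc; apply/forall_inP => v vc; apply/implyP => uv.
by have [uY ->] := couplesP nc cM uc vc uv; rewrite -E // h.
Qed.

Lemma feasible_couples f p : noncrossing (@circle_pos n n') Yt f ->
  (couples f \in feasible_matchings Y Y' p) = bichromatic Yt f (encode p).
Proof.
by move=> nc; rewrite inE perfect_matching_couples // planar_couples // andbT
  color_compatible_couples.
Qed.

Lemma planar_matching_couples M : perfect_matching Y Y' M -> planar M ->
  exists2 f, noncrossing (@circle_pos n n') Yt f & M = couples f.
Proof.
move=> /andP[/and3P[/eqP cov triv M0] /forall_inP card2] plM.
have inM y : y \in Yt -> (pblock M y \in M) && (y \in pblock M y).
  by rewrite -cov => yM; rewrite pblock_mem // mem_pblock.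
(* The other element of the block of [y]; the default is never taken on [Yt], where blocks have two
   elements. *)
pose f y := odflt y [pick z in pblock M y :\ y].
have blockE y : y \in Yt -> pblock M y = [set y; f y] /\ f y != y.
  move=> /inM/andP[bM yb]; have := card2 _ bM.
  rewrite (cardsD1 y) yb eqSS => /cards1P[z zE].
  have zz : z \in pblock M y :\ y by rewrite zE inE.
  have -> : f y = z.
    rewrite /f; case: pickP => [w|/(_ z)]; last by rewrite zz.
    by rewrite zE inE => /eqP.
  split; last by move: zz; rewrite !inE => /andP[].
  by rewrite -(setD1K yb) zE.
have bM y : y \in Yt -> [set y; f y] \in M.
  by move=> yY; have [<- _] := blockE _ yY; have /andP[] := inM _ yY.
have fY y : y \in Yt -> f y \in Yt.
  move=> yY; rewrite -cov; apply/bigcupP; exists [set y; f y]; first exact: bM.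
  by rewrite !inE eqxx orbT.
exists f; first split.
- by move=> y; exact: fY.
- by move=> y /blockE[].
- move=> y yY; have [b1 ne1] := blockE _ yY; have [b2 ne2] := blockE _ (fY _ yY).
  have e : pblock M (f y) = pblock M y.
    by apply: def_pblock => //; rewrite b1 ?bM // !inE eqxx orbT.
  have : f (f y) \in pblock M (f y) by rewrite b2 !inE eqxx orbT.
  by rewrite e b1 !inE (negbTE ne2) orbF => /eqP.
- move=> x y xY yY.
  have /forall_inP/(_ [set y; f y] (bM _ yY)) := forall_inP plM _ (bM _ xY).
  move=> /forall_inP/(_ x (set21 _ _)) /forall_inP/(_ (f x) (set22 _ _)).
  by move=> /forall_inP/(_ y (set21 _ _)) /forall_inP/(_ (f y) (set22 _ _)).
apply/setP=> c; apply/idP/imsetP => [cM|[y yY ->]]; last exact: bM.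
have /set0Pn[y yc] : c != set0 by apply: contraNneq M0 => <-.
have yY : y \in Yt by rewrite -cov; apply/bigcupP; exists c.
by exists y => //; have [<- _] := blockE _ yY; rewrite (def_pblock triv cM yc).
Qed.

End Couples.

(** Each set of feasible matchings is enumerated without repetition, so a member of the family
    counts at most once. *)
Lemma num_matchingE (n n' : nat) (Y : {set 'I_n}) (Y' : {set 'I_n'}) M s :
  num_matching Y Y' M s = (\sum_(p <- s) (M \in feasible_matchings Y Y' p))%N.
Proof.
rewrite /num_matching /matchings count_flatten sumnE -map_comp big_map.
by apply: eq_bigr => p _; rewrite /= count_uniq_mem ?enum_uniq // mem_enum.
Qed.

(** * The two families as a weight on sets of circle points *)

Section Families.
Variables (R : realType) (n n' : nat).
Variables (X Y : {set 'I_n}) (X' Y' : {set 'I_n'}).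
Hypothesis hXY : [disjoint X & Y].
Hypothesis hXY' : [disjoint X' & Y'].
Local Notation Yt := (points Y Y').
Local Notation enc := (encode Y').
(** With this upper part, the columns outside [Xt :|: enc p] are exactly those in [X' :|: p.2] when
    [p] is a proper pair. *)
Let Xt : {set point n n'} := (inl @: X) :|: (inr @: ~: (X' :|: Y')).
Implicit Type p : {set 'I_n} * {set 'I_n'}.

Lemma disjoint_points : [disjoint Xt & Yt].
Proof.
apply/pred0P => -[i|j] /=; rewrite ?mem_glue_l ?mem_glue_r.
  by apply/negP => /andP[iX]; rewrite (disjointFr hXY iX).
by rewrite !inE; case: (j \in Y'); rewrite ?orbT ?andbF.
Qed.

Lemma encode_subset p : p.1 \subset Y -> enc p \subset Yt.
Proof. by move=> p1; apply: setUSS; apply: imsetS => //; exact: subsetDl. Qed.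

Lemma minor_product_Delta (Q : 'M[R]_(n, n')) p : p \in proper_pairs X Y X' Y' ->
  minor_product X Y X' Y' Q p = Delta Q (Xt :|: enc p) * Delta Q (Xt :|: (Yt :\: enc p)).
Proof.
rewrite inE => /and4P[/subsetP p1 /subsetP p2 _ _]; rewrite /minor_product /Delta.
have h1 z : ~~ ((z \in X') && (z \in Y')) by apply/negP => /andP[/(disjointFr hXY')->].
have h2 z : (z \in p.2) ==> (z \in Y') by apply/implyP; exact: p2.
congr (minor Q _ _ * minor Q _ _); apply/setP=> z;
  rewrite [RHS]in_set [in RHS]in_setU ?[in RHS]in_setD /encode ?mem_glue_l ?mem_glue_r.
- by rewrite in_setU.
- move: (h1 z) (h2 z); rewrite !inE.
  by case: (z \in X'); case: (z \in Y'); case: (z \in p.2).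
- by rewrite in_setU in_setD andbC.
- move: (h1 z) (h2 z); rewrite !inE.
  by case: (z \in X'); case: (z \in Y'); case: (z \in p.2).
Qed.

(** The two cardinality conditions on a proper pair add up to [2|X| + |Y| = 2|X'| + |Y'|];
    complementing the columns turns this into the claim. *)
Lemma card_points_proper p : p \in proper_pairs X Y X' Y' ->
  (#|Xt|.*2 + #|Yt| = n'.*2)%N.
Proof.
rewrite inE => /and4P[p1 p2 /eqP e1 /eqP e2].
have cU (m : nat) (A B C : {set 'I_m}) : [disjoint A & B] -> C \subset B ->
    (#|A :|: C| = #|A| + #|C|)%N.
  move=> AB CB; rewrite cardsU (_ : A :&: C = set0) ?cards0 ?subn0 //.
  by apply/eqP; rewrite setI_eq0; exact: disjointWr AB.
move: e1 e2; rewrite (cU _ X Y p.1) // (cU _ X' Y' p.2) // (cU _ X Y (Y :\: p.1)) ?subsetDl //.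
rewrite (cU _ X' Y' (Y' :\: p.2)) ?subsetDl // !cardsD (setIidPr p1) (setIidPr p2).
have := subset_leq_card p1; have := subset_leq_card p2.
rewrite !card_glue; have := cardsC (X' :|: Y'); rewrite (cU _ X' Y' Y') // card_ord.
clear; lia.
Qed.

Lemma sum_encode (s : seq ({set 'I_n} * {set 'I_n'})) (F : {set point n n'} -> R) :
  {subset s <= proper_pairs X Y X' Y'} ->
  \sum_(C : {set point n n'} | C \subset Yt) (\sum_(p <- s) (enc p == C)%:R) * F C =
  \sum_(p <- s) F (enc p).
Proof.
move=> sub; under eq_bigr do rewrite mulr_suml.
rewrite exchange_big /= big_seq [RHS]big_seq; apply: eq_bigr => p /sub.
rewrite inE => /and4P[p1 _ _ _].
rewrite (bigD1 (enc p)) /=; last exact: encode_subset.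
rewrite eqxx mul1r big1 ?addr0 // => C /andP[_ Cp].
by rewrite eq_sym (negbTE Cp) mul0r.
Qed.

Definition family_difference (AA BB : seq ({set 'I_n} * {set 'I_n'})) (C : {set point n n'}) : R :=
  \sum_(p <- AA) (enc p == C)%:R - \sum_(p <- BB) (enc p == C)%:R.

Variables AA BB : seq ({set 'I_n} * {set 'I_n'}).
Hypothesis hAA : {subset AA <= proper_pairs X Y X' Y'}.
Hypothesis hBB : {subset BB <= proper_pairs X Y X' Y'}.

Lemma product_sum_families (Q : 'M[R]_(n, n')) :
  product_sum Xt Yt (Delta Q) (family_difference AA BB) =
  \sum_(p <- AA) minor_product X Y X' Y' Q p - \sum_(p <- BB) minor_product X Y X' Y' Q p.
Proof.
rewrite /product_sum; under eq_bigr do rewrite mulrBl.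
rewrite sumrB !sum_encode // big_seq [X in _ - X]big_seq [in RHS]big_seq [X in _ = _ - X]big_seq.
by congr (_ - _); apply: eq_bigr => p pA; rewrite minor_product_Delta //; [exact: hAA|exact: hBB].
Qed.

Lemma matching_sum_families f : noncrossing (@circle_pos n n') Yt f ->
  matching_sum Yt f (family_difference AA BB) =
  (num_matching Y Y' (couples Y Y' f) AA)%:R - (num_matching Y Y' (couples Y Y' f) BB)%:R.
Proof.
move=> nc; rewrite /matching_sum; under eq_bigr do rewrite mulrBl.
rewrite sumrB !sum_encode // !num_matchingE !natr_sum.
by congr (_ - _); apply: eq_bigr => p _; rewrite feasible_couples.
Qed.

End Families.

Theorem theorem2p1 (R : realType) (n n' : nat)
    (hn : (0 < n)%N) (hn' : (0 < n')%N)
    (X Y : {set 'I_n}) (X' Y' : {set 'I_n'})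
    (hXY : [disjoint X & Y]) (hXY' : [disjoint X' & Y'])
    (AA BB : seq ({set 'I_n} * {set 'I_n'}))
    (hAA : {subset AA <= proper_pairs X Y X' Y'})
    (hBB : {subset BB <= proper_pairs X Y X' Y'}) :
  tnn_universal X Y X' Y' R AA BB <->
  (forall M : {set {set point n n'}},
     M \in matchings Y Y' BB ->
     (num_matching Y Y' M BB <= num_matching Y Y' M AA)%N).
Proof.
have disj := disjoint_points X' Y' hXY; split=> [univ M MB|num Q tQ].
  have /flattenP[_ /mapP[p pB ->]] := MB; rewrite mem_enum inE => /and3P[pM _ plM].
  have [f nc ->] := planar_matching_couples pM plM.
  rewrite -(ler_nat R) -subr_ge0 -(matching_sum_families R hAA hBB nc).
  apply: (tnn_product_positive_matching disj nc).
    (* The balance condition is supplied by the member [p] of [BB] for which the matching is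
       feasible. *)
    by have := card_points_proper hXY hXY' (hBB _ pB).
  by move=> Q tQ; rewrite product_sum_families // subr_ge0; exact: univ.
rewrite -subr_ge0 -product_sum_families //; apply: tnn_matching_positive => // f nc.
rewrite (matching_sum_families R hAA hBB nc) subr_ge0 ler_nat.
(* Positivity is needed for all noncrossing matchings; one that does not occur in [BB] has count 0
   there. *)
have [/num//|/count_memPn] := boolP (couples Y Y' f \in matchings Y Y' BB).
by rewrite /num_matching => ->.
Qed.
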